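(* Let $p$ be a prime, let $\Gamma$ be an undirected graph with vertex set $\{1,\dots,d\}$ and edge set $\mathbf E$, let $F$ be the free pro-$p$ group on $x_1,\dots,x_d$ and let $l_{\mathbf E}=\{l_{ij}\}_{\{i,j\}\in\mathbf E}$ be a family of elements of $F$. Assume that: (1) $\Gamma$ is a disjoint union of two graphs $\Gamma_{\mathbf A}$ and $\Gamma_{\mathbf B}$, with sets of edges $\mathbf A$ and $\mathbf B$ respectively; (2) $\Gamma_{\mathbf A}$ is bipartite and $\phi(l_{ij}-1)\equiv [X_i;X_j]\pmod{E_3}$ for every $\{i,j\}\in\mathbf A$; (3) $l_{uv}=[x_u;x_v]$ for every $\{u,v\}\in\mathbf B$. Let $G=F/R$ be the pro-$p$ group presented by the relations $l_{\mathbf E}$, i.e. $R$ is the closed normal subgroup of $F$ generated by $l_{\mathbf E}$. Then $\mathcal E(G)=\mathcal E(\Gamma)$.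
   Context: Edges $\{i,j\}$ are indexed with the orientation $i<j$. In $F$, $[x;y]=x^{-1}y^{-1}xy$. $E=\mathbb F_p\langle\langle X_1,\dots,X_d\rangle\rangle$ is the algebra of noncommutative power series, $E_n$ is the $n$-th power of its augmentation ideal, and $\phi$ is the Magnus isomorphism from the completed group algebra $E(F)$ of $F$ over $\mathbb F_p$ to $E$, given by $x_j\mapsto 1+X_j$. $\mathcal E=\mathbb F_p\langle X_1,\dots,X_d\rangle=\bigoplus_n E_n/E_{n+1}$ is the algebra of noncommutative polynomials. In $E$ and $\mathcal E$, $[X_i;X_j]=X_iX_j-X_jX_i$. $E(G)$ is the completed group algebra of $G$ over $\mathbb F_p$, $E_n(G)$ the $n$-th power of its augmentation ideal, and $\mathcal E(G)=\bigoplus_n E_n(G)/E_{n+1}(G)$. Via $\phi$, $E(G)=E/I$, where $I$ is the closed two-sided ideal generated by the elements $\phi(l_{ij}-1)$, and $\mathcal E(G)=\mathcal E/\mathcal I$ with $\mathcal I=\bigoplus_n (I\cap E_n)/(I\cap E_{n+1})$. $\mathcal I(\Gamma)$ is the two-sided ideal of $\mathcal E$ generated by $\{[X_i;X_j]\}_{\{i,j\}\in\mathbf E}$, and $\mathcal E(\Gamma)=\mathcal E/\mathcal I(\Gamma)$. The equality $\mathcal E(G)=\mathcal E(\Gamma)$ is as quotients of $\mathcal E$. *)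

(* Defs.v *)
From HB Require Import structures.
From mathcomp Require Import all_boot all_algebra finmap.
From mathcomp Require Import boolp classical_sets functions cardinality fsbigop.
From mathcomp Require Import topology.
From mathcomp Require Import monalg.

Set Implicit Arguments.
Unset Strict Implicit.
Unset Printing Implicit Defensive.

Import GRing.Theory.

Local Open Scope classical_set_scope.
Local Open Scope ring_scope.

Section Ideals.
Variable A : nzRingType.

Definition two_sided_ideal (J : set A) : Prop :=
  [/\ J 0, forall a b, J a -> J b -> J (a + b) &
      forall a b, J b -> J (a * b) /\ J (b * a)].

Definition ideal_gen (S : set A) : set A := smallest two_sided_ideal S.

Fixpoint ideal_pow (J : set A) (n : nat) : set A :=
  if n is m.+1 then ideal_gen [set a * b | a in J & b in ideal_pow J m]
  else setT.

End Ideals.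

HB.mixin Record Group_Topological_isTopGroup G of Group G & Topological G := {
  mulg_continuous : continuous (fun gh : G * G => (gh.1 * gh.2)%g);
  invg_continuous : continuous (fun g : G => g^-1%g)
}.

#[short(type="topGroupType")]
HB.structure Definition TopGroup :=
  {G of Group G & Topological G & Group_Topological_isTopGroup G}.

Section Subgroups.
Variable G : groupType.

Definition subgroup (U : set G) : Prop :=
  [/\ U 1%g, forall g h, U g -> U h -> U (g * h)%g & forall g, U g -> U g^-1%g].

Definition normal_subgroup (U : set G) : Prop :=
  subgroup U /\ forall g h, U h -> U (h ^ g)%g.

Definition lcoset (U : set G) (g : G) : set G := [set h | U (g^-1 * h)%g].

Definition lcosets (U : set G) : set (set G) := range (lcoset U).

End Subgroups.

Definition topgroup_hom (G H : topGroupType) (f : G -> H) : Prop :=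
  continuous f /\ {morph f : g h / (g * h)%g}.

Definition pro_p (p : nat) (G : topGroupType) : Prop :=
  [/\ compact [set: G],
      hausdorff_space G,
      forall V : set G, nbhs 1%g V ->
        exists2 U : set G, open U /\ subgroup U & U `<=` V &
      forall U : set G, open U -> normal_subgroup U ->
        exists k, (lcosets U #= `I_(p ^ k))%card].

Definition free_pro_p (p d : nat) (F : topGroupType) (x : 'I_d -> F) : Prop :=
  pro_p p F /\
  forall (H : topGroupType) (y : 'I_d -> H), pro_p p H ->
    exists! f : F -> H, topgroup_hom f /\ forall i, f (x i) = y i.

Definition closed_normal_closure (G : topGroupType) (S : set G) : set G :=
  smallest (fun N => closed N /\ normal_subgroup N) S.

(* [pi] identifies [G] with [F / N]: the third clause says that [G] carries the
   quotient topology. *)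
Definition is_quotient_by (F G : topGroupType) (N : set F) (pi : F -> G) :
    Prop :=
  [/\ {morph pi : g h / (g * h)%g},
      forall y, exists g, pi g = y,
      forall V : set G, open V <-> open (pi @^-1` V) &
      pi @^-1` [set 1%g] = N].

Section Series.
Variables p d : nat.

(* A series is its family of coefficients, indexed by the words in the letters
   [0, ..., d - 1]. *)
Record ncseries : Type := NCSeries { ncoef : seq 'I_d -> 'F_p }.

HB.instance Definition _ := gen_eqMixin ncseries.
HB.instance Definition _ := gen_choiceMixin ncseries.

Implicit Types f g h : ncseries.

Definition nczero := NCSeries (fun=> 0).
Definition ncone := NCSeries (fun w => (w == [::])%:R).
Definition ncopp f := NCSeries (fun w => - ncoef f w).
Definition ncadd f g := NCSeries (fun w => ncoef f w + ncoef g w).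
Definition ncscale c f := NCSeries (fun w => c * ncoef f w).
Definition ncmul f g := NCSeries (fun w =>
  \sum_(i < (size w).+1) ncoef f (take i w) * ncoef g (drop i w)).

Lemma ncP f g : (forall w, ncoef f w = ncoef g w) -> f = g.
Proof. by case: f g => [f] [g] /= /funext ->. Qed.

Let ncaddA : associative ncadd.
Proof. by move=> f g h; apply: ncP => w /=; rewrite addrA. Qed.
Let ncaddC : commutative ncadd.
Proof. by move=> f g; apply: ncP => w /=; rewrite addrC. Qed.
Let ncadd0 : left_id nczero ncadd.
Proof. by move=> f; apply: ncP => w /=; rewrite add0r. Qed.
Let ncaddN : left_inverse nczero ncopp ncadd.
Proof. by move=> f; apply: ncP => w /=; rewrite addNr. Qed.

Let ncmul_nil f g : ncoef (ncmul f g) [::] = ncoef f [::] * ncoef g [::].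
Proof. by rewrite /= big_ord_recl big_ord0 addr0. Qed.

Let ncshift x f := NCSeries (fun w => ncoef f (x :: w)).

Let ncmul_cons f g x w : ncoef (ncmul f g) (x :: w) =
  ncoef f [::] * ncoef g (x :: w) + ncoef (ncmul (ncshift x f) g) w.
Proof. by rewrite /= big_ord_recl. Qed.

Let ncmulDl : left_distributive ncmul ncadd.
Proof.
move=> f g h; apply: ncP => w /=; rewrite -big_split.
by apply: eq_bigr => i _; rewrite mulrDl.
Qed.
Let ncmulDr : right_distributive ncmul ncadd.
Proof.
move=> f g h; apply: ncP => w /=; rewrite -big_split.
by apply: eq_bigr => i _; rewrite mulrDr.
Qed.
Let ncmulZl c f g : ncmul (ncscale c f) g = ncscale c (ncmul f g).
Proof.
by apply: ncP => w /=; rewrite mulr_sumr; apply: eq_bigr => i _; rewrite mulrA.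
Qed.

Let ncmulA : associative ncmul.
Proof.
move=> f g h; apply: ncP => w; elim: w f g h => [|x w IH] f g h.
  by rewrite !ncmul_nil mulrA.
rewrite !ncmul_cons ncmul_nil mulrDr mulrA -addrA IH; congr (_ + _).
have -> : ncshift x (ncmul f g)
    = ncadd (ncscale (ncoef f [::]) (ncshift x g)) (ncmul (ncshift x f) g).
  by apply: ncP => v; exact: ncmul_cons.
by rewrite ncmulDl ncmulZl.
Qed.

Let ncmul1 : left_id ncone ncmul.
Proof.
move=> f; apply: ncP => -[|x w]; first by rewrite ncmul_nil /= mul1r.
rewrite ncmul_cons /= mul1r big1 ?addr0 // => i _.
by rewrite /= mul0r.
Qed.
Let nc1mul : right_id ncone ncmul.
Proof.
move=> f; apply: ncP => w; elim: w f => [|x w IH] f.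
  by rewrite ncmul_nil /= mulr1.
by rewrite ncmul_cons IH /= mulr0 add0r.
Qed.
Let ncone_neq0 : ncone != nczero.
Proof.
by apply/eqP => /(congr1 (ncoef ^~ [::])) /eqP; rewrite /= oner_eq0.
Qed.

HB.instance Definition _ := GRing.isNzRing.Build ncseries
  ncaddA ncaddC ncadd0 ncaddN ncmulA ncmul1 nc1mul ncmulDl ncmulDr ncone_neq0.

Let ncscaleA a b f : ncscale a (ncscale b f) = ncscale (a * b) f.
Proof. by apply: ncP => w /=; rewrite mulrA. Qed.
Let ncscale1 : left_id 1 ncscale.
Proof. by move=> f; apply: ncP => w /=; rewrite mul1r. Qed.
Let ncscaleDr : right_distributive ncscale +%R.
Proof. by move=> c f g; apply: ncP => w /=; rewrite mulrDr. Qed.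
Let ncscaleDl f : {morph ncscale^~ f : a b / a + b}.
Proof. by move=> a b; apply: ncP => w /=; rewrite mulrDl. Qed.

HB.instance Definition _ := GRing.Zmodule_isLmodule.Build 'F_p ncseries
  ncscaleA ncscale1 ncscaleDr ncscaleDl.
HB.instance Definition _ := GRing.Lmodule_isLalgebra.Build 'F_p ncseries
  (fun c f g => esym (ncmulZl c f g)).

Definition ncvar (i : 'I_d) : ncseries :=
  NCSeries (fun w => (w == [:: i])%:R).

Definition ncseries_aug (f : ncseries) : 'F_p := ncoef f [::].

Definition ncseries_filt (n : nat) : set ncseries :=
  ideal_pow [set f | ncseries_aug f = 0] n.

End Series.

Record open_normal (G : topGroupType) := OpenNormal {
  on_set :> set G;
  on_setP : [/\ open on_set, normal_subgroup on_set &
                finite_set (lcosets on_set)] }.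

(* Sum over the cosets C in G/U of the common value of f on C, for a function f
   that is constant on each left coset of U. *)
Definition coset_sum (R : nmodType) (G : groupType) (U : set G) (f : G -> R) :
    R :=
  \sum_(C \in lcosets U) f (xget 1%g C).

(* The inverse limit of the group algebras F_p[G/U], where U ranges over the
   open normal subgroups of finite index of G: [cga_coef a U g] is the
   coefficient of the coset gU in the component of a in F_p[G/U], and
   [cga_compat] says that F_p[G/V] -> F_p[G/U] maps the component at V to the
   one at U. *)
Record cga (p : nat) (G : topGroupType) := CGA {
  cga_coef : open_normal G -> G -> 'F_p;
  cga_coset : forall (U : open_normal G) g u, on_set U u ->
    cga_coef U (g * u)%g = cga_coef U g;
  cga_compat : forall U V : open_normal G, on_set V `<=` on_set U ->
    forall g, cga_coef U g =
      coset_sum V (fun h => if h \in lcoset U g then cga_coef V h else 0) }.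

Section CosetSum.
Variables (p : nat) (G : topGroupType) (U : open_normal G).
Implicit Types (f : G -> 'F_p) (g h : G).

Lemma on1 : on_set U 1%g. Proof. by case: (on_setP U) => _ [[]]. Qed.
Lemma onM g h : on_set U g -> on_set U h -> on_set U (g * h)%g.
Proof. by case: (on_setP U) => _ [[_ H _] _] _; apply: H. Qed.
Lemma onV g : on_set U g -> on_set U g^-1%g.
Proof. by case: (on_setP U) => _ [[_ _ H] _] _; apply: H. Qed.
Lemma onJ g h : on_set U h -> on_set U (h ^ g)%g.
Proof. by case: (on_setP U) => _ [_ H] _; apply: H. Qed.
Lemma on_fin : finite_set (lcosets U). Proof. by case: (on_setP U). Qed.

Definition cconst f := forall g u, on_set U u -> f (g * u)%g = f g.

Lemma lcoset_refl g : lcoset U g g.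
Proof. by rewrite /lcoset /= mulVg; exact: on1. Qed.

Lemma lcoset_sym g h : lcoset U g h -> lcoset U h g.
Proof. by rewrite /lcoset /= => /onV; rewrite invgM invgK. Qed.

Lemma lcoset_trans g h k : lcoset U g h -> lcoset U h k -> lcoset U g k.
Proof.
by rewrite /lcoset /= => gh hk; have := onM gh hk; rewrite mulgA mulgK.
Qed.

Lemma lcoset_eq g h : lcoset U g h -> lcoset U g = lcoset U h.
Proof.
move=> gh; apply/seteqP; split=> k; last exact: lcoset_trans.
by apply: lcoset_trans; exact: lcoset_sym.
Qed.

Lemma lcoset_mem_sym g h : (h \in lcoset U g) = (g \in lcoset U h).
Proof. by apply/idP/idP; rewrite !inE; exact: lcoset_sym. Qed.

Lemma cconst_eq f g h : cconst f -> lcoset U g h -> f h = f g.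
Proof. by move=> fc gh; rewrite -(fc g _ gh) mulgA mulgV mul1g. Qed.

Lemma cconst_rep f g : cconst f -> f (xget 1%g (lcoset U g)) = f g.
Proof.
by move=> fc; apply: cconst_eq => //; apply: xgetI (lcoset_refl g).
Qed.

Lemma eq_coset_sum f f' : f =1 f' -> coset_sum U f = coset_sum U f'.
Proof. by move=> ff'; apply: eq_fsbigr => C _; exact: ff'. Qed.

Lemma coset_sumD f f' :
  coset_sum U (fun g => f g + f' g) = coset_sum U f + coset_sum U f'.
Proof. by rewrite /coset_sum fsbig_split //; exact: on_fin. Qed.

Lemma coset_sumZ c f : coset_sum U (fun g => c * f g) = c * coset_sum U f.
Proof. by rewrite /coset_sum mulr_fsumr. Qed.

Lemma coset_sumZr c f : coset_sum U (fun g => f g * c) = coset_sum U f * c.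
Proof. by rewrite /coset_sum mulr_fsuml. Qed.

Lemma coset_sum0 : coset_sum U (fun=> 0 : 'F_p) = 0.
Proof. by rewrite /coset_sum fsbig1. Qed.

Lemma coset_sumN f : coset_sum U (fun g => - f g) = - coset_sum U f.
Proof.
by rewrite -mulN1r -coset_sumZ; apply: eq_coset_sum => g; rewrite mulN1r.
Qed.

Lemma coset_sum_delta f g : cconst f ->
  coset_sum U (fun h => if h \in lcoset U g then f h else 0) = f g.
Proof.
move=> fc; rewrite /coset_sum (fsbigD1 (lcoset U g)) /=; last 2 first.
- exact: on_fin.
- by exists g.
rewrite ifT ?inE; last exact: xgetI (lcoset_refl g).
rewrite cconst_rep // fsbig1 ?addr0 // => C [[h _ <-] /= neq].
case: ifP => //; rewrite inE => gh; exfalso; apply: neq.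
rewrite (lcoset_eq gh); apply/esym/lcoset_eq.
exact: lcoset_sym (xgetI _ (lcoset_refl h)).
Qed.

Lemma coset_sum_translate k f : cconst f ->
  coset_sum U (fun h => f (k * h)%g) = coset_sum U f.
Proof.
move=> fc; rewrite /coset_sum.
rewrite [RHS](@reindex_fsbig _ _ _ _ _ (fun C => [set h | C (k^-1 * h)%g])
   (lcosets U)).
  apply: eq_fsbigr => C; rewrite inE => -[g _ <-].
  have -> : [set h | lcoset U g (k^-1 * h)%g] = lcoset U (k * g)%g.
    by apply/seteqP; split=> h; rewrite /lcoset /= invgM mulgA.
  rewrite cconst_rep //; apply: (@cconst_eq (fun h => f (k * h)%g)).
    by move=> h u Uu; rewrite mulgA; exact: fc.
  exact: (xgetI _ (lcoset_refl g)).
split.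
- move=> C [g _ <-]; exists (k * g)%g => //.
  by apply/seteqP; split=> h; rewrite /lcoset /= invgM mulgA.
- move=> C D _ _ CD; apply/seteqP; split=> h.
    by move: (congr1 (fun X => X (k * h)%g) CD) => /=; rewrite mulKg => ->.
  by move: (congr1 (fun X => X (k * h)%g) CD) => /=; rewrite mulKg => ->.
- move=> C [g _ <-]; exists (lcoset U (k^-1 * g)%g); first by exists (k^-1 * g)%g.
  apply/seteqP; split=> h; rewrite /lcoset /= invgM invgK -mulgA.
    by rewrite mulVKg.
  by rewrite mulVKg.
Qed.

End CosetSum.

Lemma exchange_coset_sum (p : nat) (G : topGroupType) (U V : open_normal G)
    (f : G -> G -> 'F_p) :
  coset_sum U (fun g => coset_sum V (f g)) =
  coset_sum V (fun h => coset_sum U (f ^~ h)).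
Proof. by rewrite /coset_sum exchange_fsbig //; exact: on_fin. Qed.

Section CompletedGroupAlgebra.
Variables (p : nat) (G : topGroupType).
Implicit Types (a b c : cga p G) (U V : open_normal G).

HB.instance Definition _ := gen_eqMixin (cga p G).
HB.instance Definition _ := gen_choiceMixin (cga p G).

Lemma cgaP a b : (forall U g, cga_coef a U g = cga_coef b U g) -> a = b.
Proof.
case: a b => [a a1 a2] [b b1 b2] /= ab.
have e : a = b by apply/funext => U; apply/funext => g.
by case: _ / e b1 b2 => b1 b2; congr CGA; exact: Prop_irrelevance.
Qed.

Let cgaC a U : cconst U (cga_coef a U).
Proof. by move=> g u; exact: cga_coset. Qed.

Let lcosetR U g h u : on_set U u ->
  (g \in lcoset U (h * u)%g) = (g \in lcoset U h).
Proof.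
move=> Uu; congr (_ \in _); apply: lcoset_eq.
by rewrite /lcoset /= invgM mulgVK; exact: onV.
Qed.

Let lcosetRr U g h u : on_set U u ->
  ((h * u)%g \in lcoset U g) = (h \in lcoset U g).
Proof. by move=> Uu; rewrite ![_ \in lcoset U g]lcoset_mem_sym lcosetR. Qed.

Program Definition cga_zero : cga p G := @CGA p G (fun _ _ => 0) _ _.
Next Obligation. by []. Qed.
Next Obligation.
by move=> U V _ g; rewrite -[LHS](coset_sum0 p V); apply: eq_coset_sum => h;
  case: ifP.
Qed.

Program Definition cga_opp a : cga p G := @CGA p G (fun U g => - cga_coef a U g) _ _.
Next Obligation. by move=> a U g u Uu /=; rewrite cga_coset. Qed.
Next Obligation.
move=> a U V VU g /=; rewrite (cga_compat a VU) -coset_sumN.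
by apply: eq_coset_sum => h; case: ifP => // _; rewrite oppr0.
Qed.

Program Definition cga_add a b : cga p G :=
  @CGA p G (fun U g => cga_coef a U g + cga_coef b U g) _ _.
Next Obligation. by move=> a b U g u Uu /=; rewrite !cga_coset. Qed.
Next Obligation.
move=> a b U V VU g /=; rewrite !(cga_compat _ VU) -coset_sumD.
by apply: eq_coset_sum => h; case: ifP => // _; rewrite addr0.
Qed.

Program Definition cga_scale (k : 'F_p) a : cga p G :=
  @CGA p G (fun U g => k * cga_coef a U g) _ _.
Next Obligation. by move=> k a U g u Uu /=; rewrite cga_coset. Qed.
Next Obligation.
move=> k a U V VU g /=; rewrite (cga_compat a VU) -coset_sumZ.
by apply: eq_coset_sum => h; case: ifP => // _; rewrite mulr0.
Qed.

Program Definition cga_of (g : G) : cga p G :=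
  @CGA p G (fun U h => (h \in lcoset U g)%:R) _ _.
Next Obligation. by move=> g U h u Uu /=; rewrite lcosetRr. Qed.
Next Obligation.
move=> g U V VU h /=; rewrite lcoset_mem_sym.
rewrite -(@coset_sum_delta p G V (fun k => (k \in lcoset U h)%:R) g); last first.
  by move=> k u /VU Uu; rewrite lcosetRr.
by apply: eq_coset_sum => k; case: (k \in lcoset V g); case: (k \in lcoset U h).
Qed.

Program Definition cga_mul a b : cga p G :=
  @CGA p G (fun U g =>
    coset_sum U (fun h => cga_coef a U h * cga_coef b U (h^-1 * g)%g)) _ _.
Next Obligation.
move=> a b U g u Uu /=; apply: eq_coset_sum => h.
by rewrite mulgA cga_coset.
Qed.
Next Obligation.
move=> a b U V VU g /=.
have bJ h k : h \in lcoset U k ->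
    cga_coef b U (h^-1 * g)%g = cga_coef b U (k^-1 * g)%g.
  rewrite inE /lcoset /= => /onV /(onJ (k^-1 * g)%g) Ukh.
  rewrite -(cga_coset b (k^-1 * g)%g Ukh); congr (cga_coef b U _).
  by rewrite /conjg mulVKg invgM invgK -mulgA mulVKg.
transitivity (coset_sum V (fun k => cga_coef a V k * cga_coef b U (k^-1 * g)%g)).
  transitivity (coset_sum U (fun h => coset_sum V (fun k =>
      if h \in lcoset U k then cga_coef a V k * cga_coef b U (k^-1 * g)%g else 0))).
    apply: eq_coset_sum => h; rewrite (cga_compat a VU) -coset_sumZr.
    apply: eq_coset_sum => k; rewrite lcoset_mem_sym.
    by case: ifP => [/bJ ->|_] //; rewrite mul0r.
  rewrite exchange_coset_sum; apply: eq_coset_sum => k.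
  exact: (@coset_sum_delta p G U
    (fun=> cga_coef a V k * cga_coef b U (k^-1 * g)%g) k).
transitivity (coset_sum V (fun k => coset_sum V (fun h =>
    if h \in lcoset U g then cga_coef a V k * cga_coef b V (k^-1 * h)%g
    else 0))).
  apply: eq_coset_sum => k; rewrite (cga_compat b VU) -coset_sumZ.
  rewrite -(@coset_sum_translate p G V k^-1%g).
    apply: eq_coset_sum => h.
    have -> : ((k^-1 * h)%g \in lcoset U (k^-1 * g)%g) = (h \in lcoset U g).
      by apply/idP/idP; rewrite !inE /lcoset /= invgM invgK -mulgA mulVKg.
    by case: ifP => // _; rewrite mulr0.
  move=> h u Vu; rewrite lcosetRr; last exact: VU.
  by case: ifP => // _; rewrite cga_coset.
rewrite exchange_coset_sum; apply: eq_coset_sum => h.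
by case: ifP => // _; rewrite coset_sum0.
Qed.

Let cga_addA : associative cga_add.
Proof. by move=> a b c; apply: cgaP => U g /=; rewrite addrA. Qed.
Let cga_addC : commutative cga_add.
Proof. by move=> a b; apply: cgaP => U g /=; rewrite addrC. Qed.
Let cga_add0 : left_id cga_zero cga_add.
Proof. by move=> a; apply: cgaP => U g /=; rewrite add0r. Qed.
Let cga_addN : left_inverse cga_zero cga_opp cga_add.
Proof. by move=> a; apply: cgaP => U g /=; rewrite addNr. Qed.

Let cga_mulA : associative cga_mul.
Proof.
move=> a b c; apply: cgaP => U g /=.
transitivity (coset_sum U (fun k => coset_sum U (fun h =>
    cga_coef a U k * (cga_coef b U (k^-1 * h)%g * cga_coef c U (h^-1 * g)%g)))).
  apply: eq_coset_sum => k; rewrite coset_sumZ; congr (_ * _).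
  rewrite -[RHS](@coset_sum_translate p G U k).
    by apply: eq_coset_sum => h; rewrite mulKg invgM mulgA.
  move=> h u Uu; rewrite mulgA cga_coset //; congr (_ * _).
  rewrite invgM -mulgA -(cga_coset c (h^-1 * g)%g (onJ (h^-1 * g)%g (onV Uu))).
  by congr (cga_coef c U _); rewrite /conjg mulVKg.
rewrite exchange_coset_sum; apply: eq_coset_sum => h; rewrite -coset_sumZr.
by apply: eq_coset_sum => k; rewrite mulrA.
Qed.

Let cga_mul1 : left_id (cga_of 1%g) cga_mul.
Proof.
move=> a; apply: cgaP => U g /=.
have fc : cconst U (fun h => cga_coef a U (h^-1 * g)%g).
  move=> h u Uu; rewrite invgM -mulgA.
  rewrite -(cga_coset a (h^-1 * g)%g (onJ (h^-1 * g)%g (onV Uu))).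
  by congr (cga_coef a U _); rewrite /conjg mulVKg.
have := coset_sum_delta 1%g fc; rewrite invg1 mul1g => <-.
by apply: eq_coset_sum => h; case: (h \in _); rewrite ?mul1r ?mul0r.
Qed.

Let cga_1mul : right_id (cga_of 1%g) cga_mul.
Proof.
move=> a; apply: cgaP => U g /=; rewrite -[RHS](coset_sum_delta g (cgaC a (U:=U))).
apply: eq_coset_sum => h.
have -> : ((h^-1 * g)%g \in lcoset U 1%g) = (h \in lcoset U g).
  rewrite [RHS]lcoset_mem_sym.
  by apply/idP/idP; rewrite !inE /lcoset /= invg1 mul1g.
by case: (h \in _); rewrite ?mulr1 ?mulr0.
Qed.

Let cga_mulDl : left_distributive cga_mul cga_add.
Proof.
move=> a b c; apply: cgaP => U g /=; rewrite -coset_sumD.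
by apply: eq_coset_sum => h; rewrite mulrDl.
Qed.
Let cga_mulDr : right_distributive cga_mul cga_add.
Proof.
move=> a b c; apply: cgaP => U g /=; rewrite -coset_sumD.
by apply: eq_coset_sum => h; rewrite mulrDr.
Qed.

Lemma whole_groupP :
  [/\ open [set: G], normal_subgroup [set: G] & finite_set (lcosets [set: G])].
Proof.
split; [exact: openT | by [] | ].
apply: (@sub_finite_set _ _ [set setT]); last exact: finite_set1.
by move=> C [g _ <-] /=; apply/seteqP.
Qed.

Definition whole_group : open_normal G := OpenNormal whole_groupP.

(* The component at U = G lives in F_p[G/G] = F_p. *)
Definition cga_aug a : 'F_p := cga_coef a whole_group 1%g.

Let cga_one_neq0 : cga_of 1%g != cga_zero.
Proof.
apply/eqP => /(congr1 cga_aug) /eqP; rewrite /cga_aug /=.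
by rewrite mem_set ?oner_eq0.
Qed.

HB.instance Definition _ := GRing.isNzRing.Build (cga p G) cga_addA cga_addC
  cga_add0 cga_addN cga_mulA cga_mul1 cga_1mul cga_mulDl cga_mulDr cga_one_neq0.

Let cga_scaleA k l a : cga_scale k (cga_scale l a) = cga_scale (k * l) a.
Proof. by apply: cgaP => U g /=; rewrite mulrA. Qed.
Let cga_scale1 : left_id 1 cga_scale.
Proof. by move=> a; apply: cgaP => U g /=; rewrite mul1r. Qed.
Let cga_scaleDr : right_distributive cga_scale +%R.
Proof. by move=> k a b; apply: cgaP => U g /=; rewrite mulrDr. Qed.
Let cga_scaleDl a : {morph cga_scale^~ a : k l / k + l}.
Proof. by move=> k l; apply: cgaP => U g /=; rewrite mulrDl. Qed.

HB.instance Definition _ := GRing.Zmodule_isLmodule.Build 'F_p (cga p G)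
  cga_scaleA cga_scale1 cga_scaleDr cga_scaleDl.

Let cga_scaleAl (k : 'F_p) (a b : cga p G) : k *: (a * b) = (k *: a) * b.
Proof.
apply: cgaP => U g /=; rewrite -coset_sumZ.
by apply: eq_coset_sum => h; rewrite mulrA.
Qed.

HB.instance Definition _ := GRing.Lmodule_isLalgebra.Build 'F_p (cga p G)
  cga_scaleAl.

Definition cga_filt (n : nat) : set (cga p G) :=
  ideal_pow [set a | cga_aug a = 0] n.

End CompletedGroupAlgebra.

(* [phi] is an isomorphism of topological F_p-algebras: E(F) carries the inverse
   limit topology, and the algebra of power series the topology for which the
   powers of the augmentation ideal form a basis of neighbourhoods of 0. *)
Definition magnus_iso (p d : nat) (F : topGroupType) (x : 'I_d -> F)
    (phi : {lrmorphism cga p F -> ncseries p d}) : Prop :=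
  [/\ bijective phi,
      forall n, exists U : open_normal F, forall a : cga p F,
        cga_coef a U =1 (fun=> 0) -> ncseries_filt n (phi a),
      forall U : open_normal F, exists n, forall a : cga p F,
        ncseries_filt n (phi a) -> cga_coef a U =1 (fun=> 0) &
      forall j, phi (cga_of p (x j)) = 1 + ncvar p j].

Definition ring_comm (A : nzRingType) (a b : A) : A := a * b - b * a.

Notation ncpoly p d := {malg 'F_p[{fmonom 'I_d}]}.

Definition ncpolyX (p d : nat) (i : 'I_d) : ncpoly p d := << fmu i >>.

Definition graph_ideal (p d : nat) (e : rel 'I_d) : set (ncpoly p d) :=
  ideal_gen [set f | exists i j : 'I_d, [/\ (i < j)%N, e i j &
                       f = ring_comm (ncpolyX p i) (ncpolyX p j)]].
Arguments graph_ideal p {d} e.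

(* The value at [y] of the homogeneous component of degree [n] of [f]. *)
Definition ncpoly_eval_deg (p d : nat) (A : lalgType 'F_p) (y : 'I_d -> A)
    (n : nat) (f : ncpoly p d) : A :=
  \sum_(m <- msupp f | size m == n) f@_m *: \prod_(i <- (m : seq 'I_d)) y i.

(* The graded algebra gr E(G) = (+)_n E_n(G)/E_{n+1}(G) is, as a quotient of the
   noncommutative polynomials via X_i |-> (y_i - 1) + E_2(G), the quotient by
   [I]. This algebra map sends the component f_n of degree n of f to the class
   of f_n(y_1 - 1, ..., y_d - 1) in E_n(G)/E_{n+1}(G); the two clauses say that
   it is onto, and that its kernel is [I]. *)
Definition gr_cga_eq_quotient (p d : nat) (G : topGroupType) (y : 'I_d -> G)
    (I : set (ncpoly p d)) : Prop :=
  let ev := ncpoly_eval_deg (fun i => cga_of p (y i) - 1) in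
  (forall n z, cga_filt n z -> exists f, cga_filt n.+1 (z - ev n f)) /\
  (forall f, (forall n, cga_filt n.+1 (ev n f)) <-> I f).

Definition simple_graph (d : nat) (V : {set 'I_d}) (e : rel 'I_d) : Prop :=
  [/\ symmetric e, irreflexive e &
      forall i j, e i j -> (i \in V) && (j \in V)].

Definition bipartite (d : nat) (V : {set 'I_d}) (e : rel 'I_d) : Prop :=
  exists V1 V2 : {set 'I_d},
    [/\ forall i, (i \in V) = (i \in V1) || (i \in V2),
        forall i, ~~ ((i \in V1) && (i \in V2)) &
        forall i j, e i j ->
          (i \in V1) && (j \in V2) || (i \in V2) && (j \in V1)].

Definition disjoint_union (d : nat) (e : rel 'I_d) (VA : {set 'I_d})
    (eA : rel 'I_d) (VB : {set 'I_d}) (eB : rel 'I_d) : Prop :=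
  (forall i, (i \in VA) (+) (i \in VB)) /\
  (forall i j, e i j = eA i j || eB i j).

(* Main.v *)
Require Import Defs.
From HB Require Import structures.
From mathcomp Require Import all_boot all_algebra finmap.
From mathcomp Require Import boolp classical_sets functions cardinality fsbigop.
From mathcomp Require Import topology.
From mathcomp Require Import monalg.

Set Implicit Arguments.
Unset Strict Implicit.
Unset Printing Implicit Defensive.

Import GRing.Theory.

Local Open Scope classical_set_scope.
Local Open Scope ring_scope.

(** Through the Magnus isomorphism the canonical map E(F) -> E(G) becomes a ring
    morphism [theta] from power series onto E(G) ([theta_surj]). It is compatible
    with augmentations, so the n-th power of the augmentation ideal of E(G) is the
    image of [E_n] ([cga_filt_theta]), which gives the surjectivity onto gr E(G).
    Its kernel lies in [I + E_n] for every n, where I is the ideal generated by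
    the series [phi (l i j - 1)] ([theta_kernel]): the elements of F congruent to 1
    modulo [I + E_n] form an open normal subgroup containing the relators. So a
    homogeneous polynomial f of degree n dies in gr E(G) exactly when f lies in
    [I + E_(n + 1)] ([cga_filt_thetaE]), and everything reduces to comparing the
    initial forms of I with the ideal generated by the commutators
    [X_i X_j - X_j X_i] of the edges.

    Each of these commutators is an initial form. For the converse
    ([series_graph_ideal]), orient the edges of the bipartite part from one side to
    the other and use the relation of such an edge as a rewriting rule
    [i j -> j i - h], with [h] of order at least 3. The source and the target of an
    edge lie on different sides, so two leading factors of a word never overlap,
    and there are no critical pairs. The relations of the second part are
    commutators up to a unit, and their letters occur in no leading factor, so
    these relations do not interfere either.

    This is exploited without normal forms. For fixed n, a linear map [reduce] from
    power series to polynomials of degree n is defined by rewriting a word at its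
    leftmost leading factor until the length is n; longer words, and shorter words
    that cannot be rewritten, go to 0. The steps terminate because each of them
    raises the length or moves a target to the left. By the absence of overlaps,
    every two-sided multiple of a relation is sent into the graph ideal
    ([reduces_rel], [reduces_free_comm]): below degree n by the very rule that
    defines the map, and in degree n because [X_i X_j - X_j X_i] is in the graph
    ideal. The map vanishes on [E_(n + 1)] and fixes the words of length n. So a
    homogeneous f of degree n in [I + E_(n + 1)] is its own image, hence lies in
    the graph ideal. *)

(** * Two-sided ideals *)

Section TwoSidedIdeals.
Variable A : nzRingType.
Implicit Types (I J S : set A).

Lemma tideal0 I : two_sided_ideal I -> I 0. Proof. by case. Qed.
Lemma tidealD I a b : two_sided_ideal I -> I a -> I b -> I (a + b).
Proof. by case=> _ H _; apply: H. Qed.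
Lemma tidealMl I a b : two_sided_ideal I -> I b -> I (a * b).
Proof. by case=> _ _ H /(H a)[]. Qed.
Lemma tidealMr I a b : two_sided_ideal I -> I b -> I (b * a).
Proof. by case=> _ _ H /(H a)[]. Qed.
Lemma tidealN I a : two_sided_ideal I -> I a -> I (- a).
Proof. by move=> tI Ia; rewrite -mulN1r; exact: tidealMl. Qed.
Lemma tidealB I a b : two_sided_ideal I -> I a -> I b -> I (a - b).
Proof. by move=> tI Ia Ib; apply: tidealD => //; exact: tidealN. Qed.
Lemma tideal_subC I a b : two_sided_ideal I -> I (a - b) -> I (b - a).
Proof. by move=> tI Iab; rewrite -opprB; exact: tidealN. Qed.
Lemma tideal_sum I (T : Type) (r : seq T) (P : pred T) (f : T -> A) :
  two_sided_ideal I -> (forall i, P i -> I (f i)) -> I (\sum_(i <- r | P i) f i).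
Proof.
move=> tI If; elim/big_rec: _ => [|i a Pi Ia]; first exact: tideal0.
by apply: tidealD => //; exact: If.
Qed.

Lemma ideal_gen_ideal S : two_sided_ideal (ideal_gen S).
Proof.
split.
- by move=> I [tI _]; exact: tideal0.
- by move=> a b Ia Ib I [tI SI]; apply: tidealD; [|exact: Ia|exact: Ib].
- by move=> a b Ib; split=> I [tI SI];
    [apply: tidealMl|apply: tidealMr] => //; exact: Ib.
Qed.

Lemma sub_ideal_gen S : S `<=` ideal_gen S.
Proof. exact: sub_smallest. Qed.

Lemma ideal_gen_min S I : two_sided_ideal I -> S `<=` I -> ideal_gen S `<=` I.
Proof. by move=> tI SI; exact: smallest_sub. Qed.

Lemma ideal_pow_ideal I n : two_sided_ideal (ideal_pow I n).
Proof. by case: n => [|n]; [split|exact: ideal_gen_ideal]. Qed.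

Definition ideal_add I J : set A := [set a | exists2 b, I b & J (a - b)].

Lemma ideal_add_ideal I J :
  two_sided_ideal I -> two_sided_ideal J -> two_sided_ideal (ideal_add I J).
Proof.
move=> tI tJ; split.
- by exists 0; rewrite ?subr0; exact: tideal0.
- move=> a a' [b Ib Jb] [b' Ib' Jb']; exists (b + b'); first exact: tidealD.
  by rewrite opprD addrACA; exact: tidealD.
- move=> a c [b Ib Jb]; split.
    by exists (a * b); rewrite -?mulrBr; exact: tidealMl.
  by exists (b * a); rewrite -?mulrBl; exact: tidealMr.
Qed.

Lemma ideal_addl I J : two_sided_ideal J -> I `<=` ideal_add I J.
Proof. by move=> tJ a Ia; exists a => //; rewrite subrr; exact: tideal0. Qed.

Lemma ideal_addr I J : two_sided_ideal I -> J `<=` ideal_add I J.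
Proof. by move=> tI a Ja; exists 0; rewrite ?subr0 //; exact: tideal0. Qed.

End TwoSidedIdeals.

Lemma tidealZ (K : nzRingType) (A : lalgType K) (I : set A) c a :
  two_sided_ideal I -> I a -> I (c *: a).
Proof. by move=> tI Ia; rewrite -[a]mul1r scalerAl; exact: tidealMl. Qed.

(** * The augmentation filtration on power series *)
Section SeriesFiltration.
Variables p d : nat.
Implicit Types (f g h : ncseries p d) (w : seq 'I_d).

Lemma ncoefD f g w : ncoef (f + g) w = ncoef f w + ncoef g w. Proof. by []. Qed.
Lemma ncoefB f g w : ncoef (f - g) w = ncoef f w - ncoef g w. Proof. by []. Qed.
Lemma ncoefZ c f w : ncoef (c *: f) w = c * ncoef f w. Proof. by []. Qed.
Lemma ncoef1 w : ncoef (1 : ncseries p d) w = (w == [::])%:R. Proof. by []. Qed.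
Lemma ncoefM f g w : ncoef (f * g) w =
  \sum_(i < (size w).+1) ncoef f (take i w) * ncoef g (drop i w).
Proof. by []. Qed.
Lemma ncoef_sum (T : Type) (r : seq T) (P : pred T) (F : T -> ncseries p d) w :
  ncoef (\sum_(i <- r | P i) F i) w = \sum_(i <- r | P i) ncoef (F i) w.
Proof. by apply: (big_morph (fun f => ncoef f w)). Qed.

Lemma ncscaleAr c f g : f * (c *: g) = c *: (f * g).
Proof.
apply: ncP => w; rewrite ncoefZ !ncoefM mulr_sumr.
by apply: eq_bigr => i _; rewrite ncoefZ mulrCA.
Qed.

Definition ncword w : ncseries p d := NCSeries (fun v => (v == w)%:R).

Lemma ncvarE i : ncvar p i = ncword [:: i]. Proof. by []. Qed.

Lemma ncoefMword w f v : ncoef (ncword w * f) v =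
  if take (size w) v == w then ncoef f (drop (size w) v) else 0.
Proof.
rewrite ncoefM; have [wv|vw] := leqP (size w) (size v); last first.
  rewrite take_oversize ?(ltnW vw) // big1; last first.
    move=> i _ /=; case: eqP => [e|]; last by rewrite mul0r.
    by move: vw; rewrite -e size_take_min ltnNge geq_minr.
  by case: eqP => // e; move: vw; rewrite e ltnn.
rewrite (bigD1 (Ordinal (wv : size w < (size v).+1)%N)) //= big1 ?addr0.
  by case: eqP; rewrite ?mul1r ?mul0r.
move=> i ne /=; case: eqP => [e|]; last by rewrite mul0r.
case/eqP: ne; apply/val_inj => /=; rewrite -e size_takel //.
by rewrite -ltnS.
Qed.

Lemma ncwordM w v : ncword w * ncword v = ncword (w ++ v).
Proof.
apply: ncP => u; rewrite ncoefMword /=.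
have [e|ne] := eqVneq (take (size w) u) w.
  by rewrite -[in RHS](cat_take_drop (size w) u) e eqseq_cat ?eqxx.
case: eqP => // e; move: ne; rewrite e take_size_cat ?eqxx //.
Qed.

Lemma ncvar_comm (i j : 'I_d) : ring_comm (ncvar p i) (ncvar p j) =
  ncword [:: i; j] - ncword [:: j; i].
Proof. by rewrite /ring_comm !ncvarE !ncwordM. Qed.

(** The elements of [E_n], by their coefficients; see [ncseries_filtE]. *)
Definition nclow n : set (ncseries p d) :=
  [set f | forall w, (size w < n)%N -> ncoef f w = 0].

Lemma nclow_ideal n : two_sided_ideal (nclow n).
Proof.
split=> [//|f g fn gn w wn|f g gn]; first by rewrite ncoefD fn ?gn ?addr0.
split=> w wn; rewrite ncoefM big1 // => i _.
  by rewrite gn ?mulr0 // size_drop (leq_ltn_trans _ wn) // leq_subr.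
by rewrite gn ?mul0r // size_take_min (leq_ltn_trans _ wn) // geq_minr.
Qed.

Lemma nclowD n f g : nclow n f -> nclow n g -> nclow n (f + g).
Proof. exact: (tidealD (@nclow_ideal n)). Qed.

Lemma nclowB n f g : nclow n f -> nclow n g -> nclow n (f - g).
Proof. exact: (tidealB (@nclow_ideal n)). Qed.

Lemma nclowM m n f g : nclow m f -> nclow n g -> nclow (m + n) (f * g).
Proof.
move=> fm gn w wmn; rewrite ncoefM big1 // => i _.
have [im|mi] := ltnP i m.
  by rewrite fm ?mul0r // size_take_min (leq_ltn_trans _ im) // geq_minl.
rewrite gn ?mulr0 // size_drop ltn_subLR; last by rewrite -ltnS.
by rewrite (leq_trans wmn) // leq_add2r.
Qed.

Lemma nclowS m n : (m <= n)%N -> nclow n `<=` nclow m.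
Proof. by move=> mn f fn w wm; apply: fn; exact: leq_trans wm mn. Qed.

Lemma nclow_word w : nclow (size w) (ncword w).
Proof. by move=> v vw /=; case: eqP => // e; move: vw; rewrite e ltnn. Qed.

(** Divide every word by its first letter. *)
Lemma nclow_shift n f : nclow n.+1 f ->
  exists g : 'I_d -> ncseries p d,
    (forall i, nclow n (g i)) /\ f = \sum_i ncvar p i * g i.
Proof.
move=> fn; exists (fun i => NCSeries (fun w => ncoef f (i :: w))); split.
  by move=> i w wn /=; apply: fn.
apply: ncP => -[|i w]; rewrite ncoef_sum.
  rewrite fn // big1 // => i _; by rewrite ncvarE ncoefMword.
rewrite (bigD1 i) // big1 => [|j ne]; rewrite ncvarE ncoefMword /=.
  by rewrite addr0 take0 drop0 eqxx.
by rewrite take0 eqseq_cons eq_sym (negbTE ne).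
Qed.

(** There are finitely many letters, so a series of order n + 1 is a finite sum
    of products of a variable and a series of order n. Hence the algebraic powers
    of the augmentation ideal need no topological closure. *)
Lemma ncseries_filtE n : @ncseries_filt p d n = nclow n.
Proof.
apply/seteqP; split.
  elim: n => [|n IH] f; first by move=> _ w.
  apply: (ideal_gen_min (@nclow_ideal n.+1)) => _ [g g1 [h hn <-]].
  rewrite -add1n; apply: nclowM; last exact: IH.
  by move=> [|//] _; exact: g1.
elim: n => [|n IH] f; first by [].
case/nclow_shift => g [gn ->]; apply: tideal_sum => [|i _].
  exact: ideal_pow_ideal.
apply: sub_ideal_gen; exists (ncvar p i) => //.
by exists (g i) => //; exact: IH.
Qed.

Definition nctrunc n f : ncseries p d :=
  \sum_(k < n.+1) \sum_(t : k.-tuple 'I_d) ncoef f t *: ncword t.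

Lemma ncoef_homog (k : nat) (c : k.-tuple 'I_d -> 'F_p) w :
  ncoef (\sum_(t : k.-tuple 'I_d) c t *: ncword t) w =
  if insub w is Some t then c t else 0.
Proof.
rewrite ncoef_sum; case: insubP => [t _ tw|/negP wk].
  rewrite (bigD1 t) // big1 => [|s st]; rewrite ncoefZ /= -tw.
    by rewrite eqxx mulr1 addr0.
  by rewrite -[_ == _ :> seq _]/(t == s) eq_sym (negbTE st) mulr0.
rewrite big1 // => t _; rewrite ncoefZ /=; case: eqP; rewrite ?mulr0 // => e.
by case: wk; rewrite e size_tuple.
Qed.

Lemma nctruncP n f : nclow n.+1 (f - nctrunc n f).
Proof.
move=> w wn; rewrite ncoefB /nctrunc ncoef_sum.
rewrite (bigD1 (Ordinal wn)) //= ncoef_homog insubT //= big1 ?addr0 ?subrr //.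
move=> k ne; rewrite ncoef_homog insubN //; apply: contra ne => /eqP e.
by apply/eqP/val_inj; rewrite /= e.
Qed.

End SeriesFiltration.

(** * Completed group algebras *)
Section CompletedAlgebra.
Variables (p : nat) (G : topGroupType).
Implicit Types (a b : cga p G) (U V : open_normal G) (g h k : G).

Lemma cga_coefB a b U g : cga_coef (a - b) U g = cga_coef a U g - cga_coef b U g.
Proof. by []. Qed.
Lemma cga_coefZ c a U g : cga_coef (c *: a) U g = c * cga_coef a U g.
Proof. by []. Qed.
Lemma cga_coefM a b U g : cga_coef (a * b) U g =
  coset_sum U (fun h => cga_coef a U h * cga_coef b U (h^-1 * g)%g).
Proof. by []. Qed.
Lemma cga_coef_of g U k : cga_coef (cga_of p g) U k = (k \in lcoset U g)%:R.
Proof. by []. Qed.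

Lemma cga_cconst a U : cconst U (cga_coef a U).
Proof. by move=> g u; exact: cga_coset. Qed.

Lemma cga_coef_lcoset a U g h : lcoset U g h -> cga_coef a U h = cga_coef a U g.
Proof. exact: cconst_eq (@cga_cconst a U). Qed.

Lemma cga_coef_coset_sum U V (f : G -> cga p G) k :
  cga_coef (coset_sum U f) V k = coset_sum U (fun g => cga_coef (f g) V k).
Proof.
rewrite /coset_sum !fsbig_finite; [|exact: on_fin..].
exact: (big_morph (fun a => cga_coef a V k)).
Qed.

Lemma cga_of_mulE g b U k :
  cga_coef (cga_of p g * b) U k = cga_coef b U (g^-1 * k)%g.
Proof.
have fc : cconst U (fun h => cga_coef b U (h^-1 * k)%g).
  move=> h u Uu; apply: cga_coef_lcoset.
  have := onJ (h^-1 * k)%g (onV Uu).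
  by rewrite /lcoset /= /conjg !invgM !invgK !mulgA.
rewrite cga_coefM -[RHS](coset_sum_delta g fc); apply: eq_coset_sum => h.
by rewrite cga_coef_of; case: (h \in _); rewrite ?mul1r ?mul0r.
Qed.

Lemma cga_ofM g h : cga_of p (g * h)%g = cga_of p g * cga_of p h.
Proof.
apply: cgaP => U k; rewrite cga_of_mulE !cga_coef_of; congr ((nat_of_bool _)%:R).
by apply/idP/idP; rewrite !inE /lcoset /= invgM mulgA.
Qed.

Lemma cga_coef_ext a U V : on_set U = on_set V -> cga_coef a U = cga_coef a V.
Proof.
case: U V => [U UP] [V VP] /= e; case: _ / e VP => VP.
by congr (cga_coef a (OpenNormal _)); exact: Prop_irrelevance.
Qed.

Lemma cga_coef_coarser a b U V : on_set V `<=` on_set U ->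
  cga_coef a V =1 cga_coef b V -> cga_coef a U =1 cga_coef b U.
Proof.
move=> VU ab g; rewrite !(cga_compat _ VU); apply: eq_coset_sum => h.
by rewrite ab.
Qed.

Lemma cga_of_coarser U g h : lcoset U g h ->
  cga_coef (cga_of p g) U =1 cga_coef (cga_of p h) U.
Proof. by move=> gh k; rewrite !cga_coef_of (lcoset_eq gh). Qed.

(** A lift to the completed algebra of the element of [F_p[G/U]] with
    coefficients [f]. *)
Definition group_sum U (f : G -> 'F_p) : cga p G :=
  coset_sum U (fun g => f g *: cga_of p g).

Lemma group_sum_coef U f : cconst U f -> cga_coef (group_sum U f) U =1 f.
Proof.
move=> fc k; rewrite cga_coef_coset_sum -[RHS](coset_sum_delta k fc).
apply: eq_coset_sum => h; rewrite cga_coefZ cga_coef_of lcoset_mem_sym.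
by case: (h \in _); rewrite ?mulr1 ?mulr0.
Qed.

Lemma cga_augE a U g : on_set U = [set: G] -> cga_coef a U g = cga_aug a.
Proof.
move=> UT; rewrite (cga_coef_ext a (V := whole_group G)) //.
exact: cga_coef_lcoset.
Qed.

Lemma cga_augM a b : cga_aug (a * b) = cga_aug a * cga_aug b.
Proof.
rewrite /cga_aug cga_coefM /coset_sum.
have -> : lcosets (whole_group G) = [set setT].
  apply/seteqP; split=> [C [g _ <-]|C ->]; first by apply/seteqP.
  by exists 1%g => //; apply/seteqP.
by rewrite fsbig_set1 !cga_augE.
Qed.

Lemma cga_aug1 : cga_aug (1 : cga p G) = 1.
Proof. by rewrite /cga_aug -[1 : cga p G]/(cga_of p 1%g) /= mem_set. Qed.

End CompletedAlgebra.

(** * Functoriality of the completed group algebra *)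
Section Pushforward.
Variables (p : nat) (F G : topGroupType) (pi : F -> G) (s : G -> F).
Hypothesis piM : {morph pi : g h / (g * h)%g}.
Hypothesis piK : forall y, pi (s y) = y.
Hypothesis pi_open : forall V : set G, open V <-> open (pi @^-1` V).
Implicit Types (V : open_normal G) (a b : cga p F) (g h : F) (x y : G).

Let pi1 : pi 1%g = 1%g.
Proof. by apply: (mulgI (pi 1%g)); rewrite -piM !mulg1. Qed.
Let piV g : pi g^-1%g = (pi g)^-1%g.
Proof. by apply: (mulgI (pi g)); rewrite -piM !mulgV pi1. Qed.

Let pi_preimage_inj : injective (fun C : set G => pi @^-1` C).
Proof.
move=> C D CD; apply/seteqP; split=> y;
  by move: (congr1 (fun X => X (s y)) CD); rewrite /= piK => ->.
Qed.

Lemma lcoset_preimage (V : set G) g :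
  lcoset (pi @^-1` V) g = pi @^-1` (lcoset V (pi g)).
Proof. by apply/seteqP; split=> h; rewrite /lcoset /= piM piV. Qed.

Lemma preimage_open_normalP V :
  [/\ open (pi @^-1` V), normal_subgroup (pi @^-1` V) &
      finite_set (lcosets (pi @^-1` V))].
Proof.
have [oV _ _] := on_setP V; split; first exact/pi_open.
  split; [split|].
  - by rewrite /= pi1; exact: on1.
  - by move=> g h Vg Vh; rewrite /= piM; exact: onM.
  - by move=> g Vg; rewrite /= piV; exact: onV.
  - by move=> g h Vh; rewrite /= /conjg !piM piV; exact: onJ.
apply: (@sub_finite_set _ _ ((fun C : set G => pi @^-1` C) @` lcosets V)).
  move=> C [g _ <-]; exists (lcoset V (pi g)); first by exists (pi g).
  by rewrite lcoset_preimage.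
exact/finite_image/on_fin.
Qed.

Definition preimage_on V : open_normal F := OpenNormal (preimage_open_normalP V).

Lemma coset_sum_preimage V (f : G -> 'F_p) : cconst V f ->
  coset_sum (preimage_on V) (f \o pi) = coset_sum V f.
Proof.
move=> fc; rewrite /coset_sum.
rewrite (@reindex_fsbig _ _ _ _ _ (fun C => pi @^-1` C) (lcosets V)).
  apply: eq_fsbigr => C; rewrite inE => -[y _ <-] /=.
  have V1 := xgetI 1%g (lcoset_refl V y).
  have V2 : lcoset V y (pi (xget 1%g (pi @^-1` lcoset V y))).
    have Vsy : (pi @^-1` lcoset V y) (s y) by rewrite /= piK; exact: lcoset_refl.
    exact: (xgetI 1%g Vsy).
  by rewrite (cconst_eq fc V1) (cconst_eq fc V2).
split.
- move=> C [y _ <-]; exists (s y) => //=.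
  by rewrite lcoset_preimage piK.
- by move=> C D _ _; exact: pi_preimage_inj.
- move=> C [g _ <-]; exists (lcoset V (pi g)); first by exists (pi g).
  by rewrite /= lcoset_preimage.
Qed.

Lemma cga_coef_preimage a V g h : pi g = pi h ->
  cga_coef a (preimage_on V) g = cga_coef a (preimage_on V) h.
Proof.
move=> gh; apply: cga_coef_lcoset.
by rewrite /= lcoset_preimage /= gh; exact: lcoset_refl.
Qed.

(** As [F / pi^-1 V] is [G / V], the components of an element of E(F) at the
    preimages of the open normal subgroups of G are an element of E(G). The
    section [s] only names a preimage of each element of G. *)
Program Definition cga_push a : cga p G :=
  @CGA p G (fun V y => cga_coef a (preimage_on V) (s y)) _ _.
Next Obligation.
move=> a V y u Vu /=.
rewrite (@cga_coef_preimage a V _ (s y * s u)%g); last by rewrite piM !piK.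
by rewrite cga_coset //= piK.
Qed.
Next Obligation.
move=> a V W WV y /=.
have sub : on_set (preimage_on W) `<=` on_set (preimage_on V).
  by move=> g /WV.
rewrite (cga_compat a sub) -coset_sum_preimage; last first.
  move=> x u Wu; rewrite (@cga_coef_preimage a W _ (s x * s u)%g); last first.
    by rewrite piM !piK.
  rewrite cga_coset /= ?piK //.
  suff -> : ((x * u)%g \in lcoset V y) = (x \in lcoset V y) by [].
  rewrite ![_ \in lcoset V y]lcoset_mem_sym; congr (_ \in _).
  by apply: esym; apply: lcoset_eq; rewrite /lcoset /= mulKg; exact: WV.
apply: eq_coset_sum => g /=.
rewrite (@cga_coef_preimage a W (s (pi g)) g) ?piK //.
suff -> : (pi g \in lcoset V y) = (g \in lcoset (preimage_on V) (s y)) by [].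
by rewrite /= lcoset_preimage piK; apply/idP/idP; rewrite !inE.
Qed.

Lemma cga_push_coef a V g :
  cga_coef (cga_push a) V (pi g) = cga_coef a (preimage_on V) g.
Proof. by apply: cga_coef_preimage; rewrite piK. Qed.

Lemma cga_pushD a b : cga_push (a + b) = cga_push a + cga_push b.
Proof. exact: cgaP. Qed.

Lemma cga_pushB a b : cga_push (a - b) = cga_push a - cga_push b.
Proof. exact: cgaP. Qed.

Lemma cga_pushZ c a : cga_push (c *: a) = c *: cga_push a.
Proof. exact: cgaP. Qed.

Lemma cga_push_of g : cga_push (cga_of p g) = cga_of p (pi g).
Proof.
apply: cgaP => V y; rewrite -(piK y) cga_push_coef !cga_coef_of.
congr ((nat_of_bool _)%:R).
by rewrite /= lcoset_preimage; apply/idP/idP; rewrite !inE.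
Qed.

Lemma cga_push1 : cga_push 1 = 1.
Proof. by rewrite -[1 : cga p F]/(cga_of p 1%g) cga_push_of pi1. Qed.

Lemma cga_pushM a b : cga_push (a * b) = cga_push a * cga_push b.
Proof.
apply: cgaP => V y; rewrite -(piK y) cga_push_coef !cga_coefM.
rewrite -coset_sum_preimage; last first.
  move=> x u Vu; rewrite cga_coset //; congr (_ * _).
  have := cga_of_mulE (x * u)%g (cga_push b) V (pi (s y)) => <-.
  rewrite -cga_of_mulE; apply: (@cga_coef_coarser _ _ _ _ V V) => // k.
  rewrite !cga_of_mulE; apply: cga_coef_lcoset.
  have := onJ (x^-1 * k)%g (onV Vu).
  by rewrite /lcoset /= /conjg !invgM !invgK !mulgA.
apply: eq_coset_sum => h.
by rewrite /comp cga_push_coef -piV -piM cga_push_coef.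
Qed.

Lemma cga_aug_push a : cga_aug (cga_push a) = cga_aug a.
Proof. by rewrite {1}/cga_aug /= (@cga_augE _ _ a). Qed.

End Pushforward.

(** * Open subgroups *)
Section OpenSubgroups.
Variable G : topGroupType.
Implicit Types (U V : open_normal G) (H : set G) (g h : G).

Lemma open_lcoset U g : open (lcoset U g).
Proof.
have [oU _ _] := on_setP U.
have -> : lcoset U g = (fun h => g^-1 * h)%g @^-1` U by [].
apply: open_comp => // h _.
have -> : (fun h => g^-1 * h)%g =
    (fun gh : G * G => (gh.1 * gh.2)%g) \o (pair g^-1%g).
  by [].
apply: continuous_comp; last exact: mulg_continuous.
by apply: cvg_pair; [exact: cvg_cst|exact: cvg_id].
Qed.

(** A subgroup [H] containing an open normal [U] is a union of cosets of [U], and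
    so is its complement: [H] is open, closed and of finite index. *)
Section Overgroup.
Variables (U : open_normal G) (H : set G).
Hypotheses (sH : subgroup H) (UH : U `<=` H).

Let lcoset_over g h : lcoset U g h -> H g <-> H h.
Proof.
have [H1 HM HV] := sH; move=> /UH gh; split=> [Hg|Hh].
  by rewrite -(mulVKg g h); exact: HM.
have -> : g = (h * (g^-1 * h)^-1)%g by rewrite invgM invgK mulVKg.
by apply: HM => //; exact: HV.
Qed.

Lemma open_overgroup : open H.
Proof.
rewrite openE => g Hg; rewrite /interior nbhsE.
exists (lcoset U g); last first.
  by move=> h /lcoset_over <-.
by split; [exact: open_lcoset|exact: lcoset_refl].
Qed.

Lemma closed_overgroup : closed H.
Proof.
rewrite -openC openE => g nHg; rewrite /interior nbhsE.
exists (lcoset U g); last first.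
  by move=> h /lcoset_over gh /gh.
by split; [exact: open_lcoset|exact: lcoset_refl].
Qed.

Lemma finite_overgroup : finite_set (lcosets H).
Proof.
apply: (@sub_finite_set _ _ ((fun C => lcoset H (xget 1%g C)) @` lcosets U));
  last exact/finite_image/on_fin.
move=> C [g _ <-]; exists (lcoset U g); first by exists g.
have [H1 HM HV] := sH; have /UH gr := xgetI 1%g (lcoset_refl U g).
set r := xget _ _ in gr *; apply/seteqP; split=> h; rewrite /lcoset /=.
  by move=> rh; rewrite -(mulVKg r h) mulgA; exact: HM.
move=> gh; have -> : (r^-1 * h = (g^-1 * r)^-1 * (g^-1 * h))%g.
  by rewrite invgM invgK -mulgA mulVKg.
by apply: HM => //; exact: HV.
Qed.

End Overgroup.

Lemma open_normal_bigcap (T : finType) (V : T -> open_normal G) :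
  exists W : open_normal G, forall t, W `<=` V t.
Proof.
suff [W Wi] : exists W : open_normal G, forall t, t \in enum T -> W `<=` V t.
  by exists W => t; apply: Wi; rewrite mem_enum.
elim: (enum T) => [|t r [W Wr]]; first by exists (whole_group G).
have WVP : [/\ open (W `&` V t), normal_subgroup (W `&` V t) &
               finite_set (lcosets (W `&` V t))].
  have [[oW _ _] [oV _ _]] := (on_setP W, on_setP (V t)).
  split; first exact: openI.
    split; [split|].
    - by split; exact: on1.
    - by move=> g h [? ?] [? ?]; split; exact: onM.
    - by move=> g [? ?]; split; exact: onV.
    - by move=> g h [? ?]; split; exact: onJ.
  apply: (@sub_finite_set _ _
    ((fun CD : set G * set G => CD.1 `&` CD.2) @` (lcosets W `*` lcosets (V t)))).
    move=> C [g _ <-]; exists (lcoset W g, lcoset (V t) g) => //.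
    by split; exists g.
  by apply/finite_image/finite_setX; exact: on_fin.
exists (OpenNormal WVP) => u; rewrite inE => /orP[/eqP ->|ur] g [] //.
by move=> Wg _; exact: Wr Wg.
Qed.

End OpenSubgroups.

Section CoarserSums.
Variables (p : nat) (G : topGroupType) (U0 U : open_normal G).
Hypothesis U0U : on_set U0 `<=` on_set U.
Variable a : cga p G.

(** The coefficient of [a] at a coset of [U] is the sum of its coefficients at
    the cosets of [U0] inside it. *)
Lemma coset_sum_coarser (k : G -> 'F_p) : cconst U k ->
  coset_sum U0 (fun g => cga_coef a U0 g * k g) =
  coset_sum U (fun g => cga_coef a U g * k g).
Proof.
move=> kc; transitivity (coset_sum U0 (fun g => coset_sum U (fun h =>
    if h \in lcoset U g then cga_coef a U0 g * k h else 0))).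
  apply: eq_coset_sum => g; rewrite -(coset_sum_delta g kc) -coset_sumZ.
  by apply: eq_coset_sum => h; case: ifP; rewrite ?mulr0.
rewrite exchange_coset_sum; apply: eq_coset_sum => h.
rewrite (cga_compat a U0U) -coset_sumZr; apply: eq_coset_sum => g.
by rewrite lcoset_mem_sym; case: ifP; rewrite ?mul0r.
Qed.

(** Once the representative of each coset of [U0] is replaced by that of the
    coset of [U] around it, the terms group into the component of [a] at [U]. *)
Lemma coset_sum_rep_vanish : cga_coef a U =1 (fun=> 0) ->
  coset_sum U0 (fun g => cga_coef a U0 g *: cga_of p (xget 1%g (lcoset U g))) = 0.
Proof.
move=> aU; apply: cgaP => W k; rewrite cga_coef_coset_sum.
rewrite (coset_sum_coarser (k := fun g =>
  cga_coef (cga_of p (xget 1%g (lcoset U g))) W k)).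
  rewrite -[RHS](coset_sum0 p U); apply: eq_coset_sum => g.
  by rewrite aU mul0r.
move=> g u Uu; congr (cga_coef (cga_of _ (xget _ _)) _ _).
by apply/esym/lcoset_eq; rewrite /lcoset /= mulKg.
Qed.

End CoarserSums.

(** * The completed group algebra of a presented group *)
Section Presentation.
Variables (p d : nat) (F G : topGroupType) (pi : F -> G) (s : G -> F).
Hypothesis piM : {morph pi : g h / (g * h)%g}.
Hypothesis piK : forall y, pi (s y) = y.
Hypothesis pi_open : forall V : set G, open V <-> open (pi @^-1` V).
Variables (phi : {lrmorphism cga p F -> ncseries p d}).
Variables (psi : ncseries p d -> cga p F).
Hypotheses (phiK : cancel phi psi) (psiK : cancel psi phi).
Hypothesis phi_cont : forall n, exists U : open_normal F, forall a,
  cga_coef a U =1 (fun=> 0) -> nclow n (phi a).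
Hypothesis psi_cont : forall U : open_normal F, exists n, forall a,
  nclow n (phi a) -> cga_coef a U =1 (fun=> 0).
Implicit Types (f g : ncseries p d) (a : cga p F) (b : cga p G).
Implicit Types (U : open_normal F) (V W : open_normal G).

Let phi_inj : injective phi := can_inj phiK.

(** A series [f] without constant term has [f ^+ n] in [E_n], so the continuous
    character of the power series algebra that [phi] transports from the
    augmentation of E(F) kills a power of [f], hence [f] itself. *)
Lemma aug_phi a : ncseries_aug (phi a) = cga_aug a.
Proof.
set c := ncseries_aug _; pose a0 := a - c *: 1.
have [n nP] := psi_cont (whole_group F).
have a0_low : nclow 1 (phi a0).
  move=> [|//] _; rewrite /a0 linearB linearZ rmorph1 ncoefB ncoefZ ncoef1.
  by rewrite mulr1 subrr.
have a0n_low m : nclow m (phi (a0 ^+ m)).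
  elim: m => [//|m IH]; rewrite exprS rmorphM -add1n; exact: nclowM.
have a0n : cga_aug (a0 ^+ n) = 0 by rewrite /cga_aug nP.
have a00 : cga_aug a0 = 0.
  apply/eqP; have : cga_aug (a0 ^+ n) == 0 by apply/eqP.
  have -> : cga_aug (a0 ^+ n) = cga_aug a0 ^+ n.
    elim: (n) => [|m IH]; first exact: cga_aug1.
    by rewrite !exprS cga_augM IH.
  by rewrite expf_eq0 => /andP[].
apply/eqP; rewrite eq_sym -subr_eq0; apply/eqP.
rewrite -[RHS]a00 /a0 /cga_aug cga_coefB cga_coefZ.
by rewrite -[cga_coef 1 _ _]/(cga_aug (1 : cga p F)) cga_aug1 mulr1.
Qed.

Let push := @cga_push p F G pi s piM piK pi_open.

(** The canonical map E(F) -> E(G), read on power series through the Magnus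
    isomorphism. *)
Definition theta f : cga p G := push (psi f).

Lemma psi_morph (op : cga p F -> cga p F -> cga p F) op' :
  {morph phi : a b / op a b >-> op' a b} ->
  {morph psi : f g / op' f g >-> op f g}.
Proof. by move=> H f g; apply: phi_inj; rewrite H !psiK. Qed.

Lemma thetaD f g : theta (f + g) = theta f + theta g.
Proof. by rewrite /theta (psi_morph (raddfD phi)) /push cga_pushD. Qed.

Lemma thetaB f g : theta (f - g) = theta f - theta g.
Proof.
by rewrite /theta (@psi_morph (fun x y => x - y) _ (raddfB phi)) /push cga_pushB.
Qed.

Lemma thetaM f g : theta (f * g) = theta f * theta g.
Proof. by rewrite /theta (psi_morph (rmorphM phi)) /push cga_pushM. Qed.

Lemma theta1 : theta 1 = 1.
Proof.
by rewrite /theta -(rmorph1 phi) phiK /push cga_push1.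
Qed.

Lemma thetaZ c f : theta (c *: f) = c *: theta f.
Proof.
rewrite /theta -[f in LHS]psiK -linearZ phiK /push; exact: cga_pushZ.
Qed.

Lemma theta0 : theta 0 = 0.
Proof. by rewrite -(subrr 0) thetaB subrr. Qed.

Lemma theta_sum (I : Type) (r : seq I) (P : pred I) (E : I -> ncseries p d) :
  theta (\sum_(i <- r | P i) E i) = \sum_(i <- r | P i) theta (E i).
Proof. exact: (big_morph _ thetaD theta0). Qed.

Lemma theta_phi_of x : theta (phi (cga_of p x)) = cga_of p (pi x).
Proof. by rewrite /theta phiK /push cga_push_of. Qed.

Lemma aug_theta f : cga_aug (theta f) = ncoef f [::].
Proof. by rewrite /theta /push cga_aug_push -aug_phi psiK. Qed.

Lemma theta_coef_low V : exists n, forall f g, nclow n (f - g) ->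
  cga_coef (theta f) V =1 cga_coef (theta g) V.
Proof.
have [n nP] := psi_cont (preimage_on piM pi_open V).
exists n => f g fg y; apply/eqP; rewrite -subr_eq0 -cga_coefB -thetaB.
by rewrite -[y]piK /theta /push cga_push_coef nP // psiK.
Qed.

Section Lifting.
Variable b : cga p G.

Let lifts V f := cga_coef (theta f) V =1 cga_coef b V.

Let liftable n f := forall V, exists2 g, lifts V g & nclow n (g - f).

Let liftable0 f : liftable 0 f.
Proof.
move=> V; pose U := preimage_on piM pi_open V.
exists (phi (group_sum U (cga_coef b V \o pi))) => // y.
rewrite -[y]piK /theta phiK /push cga_push_coef group_sum_coef //.
by move=> h u Uu; rewrite /= piM cga_coset.
Qed.

Let liftableS n f : liftable n f ->
  exists2 f', nclow n (f' - f) & liftable n.+1 f'.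
Proof.
move=> fn; pose E (c : {ffun n.-tuple 'I_d -> 'F_p}) :=
  \sum_(t : n.-tuple 'I_d) c t *: ncword p t.
have Elow c : nclow n (E c).
  move=> w wn; rewrite ncoef_homog insubN //; by rewrite ltn_eqF.
apply: contrapT => nof'.
have /choice[V VP] : forall c, exists V,
    forall g, lifts V g -> ~ nclow n.+1 (g - (f + E c)).
  move=> c; apply: contrapT => noV; apply: nof'; exists (f + E c).
    by rewrite addrC addKr.
  move=> V; apply: contrapT => nog; apply: noV; exists V => g gV gn.
  by apply: nog; exists g.
have [W WV] := open_normal_bigcap V.
have [g gW gf] := fn W.
pose c := [ffun t : n.-tuple 'I_d => ncoef (g - f) t].
apply: (VP c g); first exact: cga_coef_coarser (WV c) gW.
move=> w wn; rewrite opprD addrA ncoefB ncoef_homog.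
case: insubP => [t _ <-|wn']; first by rewrite ffunE subrr.
rewrite subr0; apply: gf; move: wn; rewrite ltnS leq_eqVlt => /orP[|//].
by move=> e; rewrite e in wn'.
Qed.

(** A compactness argument in the manner of Koenig. Call a truncation of order n
    liftable if for every V it extends to a series with the right component at
    V. A liftable truncation of order n has only finitely many extensions to order
    n + 1; if each of them failed at some V, all would fail at the intersection of
    these V. So a compatible sequence of liftable truncations exists, and its
    limit works at every V because each component depends on finitely many
    coefficients. *)
Lemma theta_surj : exists f, theta f = b.
Proof.
have /choice[next nextP] : forall nf : nat * ncseries p d, exists f',
    liftable nf.1 nf.2 -> nclow nf.1 (f' - nf.2) /\ liftable nf.1.+1 f'.
  move=> [n f]; have [fn|nfn] := pselect (liftable n f); last by exists 0.
  by have [f' ? ?] := liftableS fn; exists f'.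
pose fix sq n := if n is m.+1 then next (m, sq m) else 0.
have sqL n : liftable n (sq n).
  elim: n => [|n IH]; first exact: liftable0.
  by have [] := nextP (n, sq n) IH.
have sqS n : nclow n (sq n.+1 - sq n) by have [] := nextP (n, sq n) (sqL n).
pose f : ncseries p d := NCSeries (fun w => ncoef (sq (size w).+1) w).
have fsq n : nclow n (f - sq n).
  move=> w; rewrite ncoefB [ncoef f w]/=; elim: n => [//|n IH].
  rewrite ltnS leq_eqVlt => /orP[/eqP ->|wn]; first by rewrite subrr.
  have /eqP := sqS n w wn; rewrite ncoefB subr_eq0 => /eqP ->.
  exact: IH.
exists f; apply: cgaP => V; have [n nP] := theta_coef_low V.
have [g gV gn] := sqL n V; move=> y; rewrite -gV; apply: nP.
have -> : f - g = (f - sq n) - (g - sq n) by rewrite opprB addrA subrK.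
exact: nclowB.
Qed.

End Lifting.

(** Augmentation ideals correspond under the surjection [theta], hence so do
    their powers. *)
Lemma cga_filt_theta n b :
  cga_filt n b <-> exists2 f, nclow n f & theta f = b.
Proof.
split.
  elim: n b => [|n IH] b; first by have [f <-] := theta_surj b; exists f.
  pose K : set (cga p G) := [set b | exists2 f, nclow n.+1 f & theta f = b].
  have tI : two_sided_ideal K.
    have tn := @nclow_ideal p d n.+1; split.
    - by exists 0; [exact: tideal0|exact: theta0].
    - move=> _ _ [f fn <-] [g gn <-]; exists (f + g); last exact: thetaD.
      exact: nclowD.
    - move=> b1 _ [f fn <-]; have [g <-] := theta_surj b1; split.
        by exists (g * f); [exact: (tidealMl _ tn)|exact: thetaM].
      by exists (f * g); [exact: (tidealMr _ tn)|exact: thetaM].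
  suff : @cga_filt p G n.+1 `<=` K by apply.
  apply: ideal_gen_min tI _ => _ [b1 b1_aug [b2 /IH[g gn <-] <-]].
  have [f fb] := theta_surj b1; exists (f * g); last by rewrite thetaM fb.
  rewrite -add1n; apply: nclowM => // -[|//] _.
  by rewrite -aug_theta fb.
case=> f + <-; elim: n f => [//|n IH] f /nclow_shift[g [gn ->]].
rewrite theta_sum; apply: tideal_sum => [|i _]; first exact: ideal_pow_ideal.
rewrite thetaM; apply: sub_ideal_gen; exists (theta (ncvar p i)).
  exact: aug_theta.
by exists (theta (g i)) => //; apply: IH.
Qed.

Section Kernel.
Variables (N R : set F).
Hypothesis N_ker : pi @^-1` [set 1%g] = N.
Hypothesis N_gen : N = closed_normal_closure R.

Definition relators : set (ncseries p d) :=
  [set phi (cga_of p r - 1) | r in R].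

(** The closed ideal generated by the relators is the intersection of these
    ideals; only one of them matters in each degree. *)
Definition rel_ideal n := ideal_add (ideal_gen relators) (nclow n).

Lemma rel_ideal_ideal n : two_sided_ideal (rel_ideal n).
Proof.
by apply: ideal_add_ideal; [exact: ideal_gen_ideal|exact: nclow_ideal].
Qed.

Lemma nclow_rel_ideal n : nclow n `<=` rel_ideal n.
Proof. exact/ideal_addr/ideal_gen_ideal. Qed.

Lemma theta_relators f : ideal_gen relators f -> theta f = 0.
Proof.
suff : ideal_gen relators `<=` [set f | theta f = 0] by apply.
apply: ideal_gen_min.
  split=> [|g h g0 h0|g h h0]; rewrite /= ?theta0 //.
    by rewrite thetaD g0 h0 addr0.
  by rewrite !thetaM h0 mulr0 mul0r.
move=> _ [r Rr <-]; rewrite /= rmorphB rmorph1 thetaB theta1 theta_phi_of.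
have Nr : N r by rewrite N_gen => K [_]; apply.
by move: Nr; rewrite -N_ker /= => ->; exact: subrr.
Qed.

Let congr_one n : set F := [set x | rel_ideal n (phi (cga_of p x - 1))].

Let congr_one_subgroup n : subgroup (congr_one n).
Proof.
have tI := rel_ideal_ideal n; split.
- rewrite /congr_one /= -[X in _ - X]/(cga_of p 1%g) subrr rmorph0.
  exact: (tideal0 tI).
- move=> x y xn yn; rewrite /congr_one /= cga_ofM.
  have -> : cga_of p x * cga_of p y - 1 =
      cga_of p x * (cga_of p y - 1) + (cga_of p x - 1).
    by rewrite mulrBr mulr1 addrA subrK.
  by rewrite rmorphD (rmorphM phi); apply: (tidealD tI) => //;
    exact: (tidealMl _ tI).
- move=> x xn; rewrite /congr_one /=.
  have -> : cga_of p x^-1%g - 1 = - (cga_of p x^-1%g * (cga_of p x - 1)).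
    by rewrite mulrBr mulr1 -cga_ofM mulVg opprB.
  by rewrite rmorphN (rmorphM phi); apply: (tidealN tI); exact: (tidealMl _ tI).
Qed.

Let congr_one_normal n : normal_subgroup (congr_one n).
Proof.
have tI := rel_ideal_ideal n; split=> // x y yn; rewrite /congr_one /=.
have -> : cga_of p (y ^ x)%g - 1 =
    cga_of p x^-1%g * (cga_of p y - 1) * cga_of p x.
  rewrite mulrBr mulrBl mulr1 -!cga_ofM mulVg.
  by rewrite /conjg mulgA.
by rewrite !(rmorphM phi); apply: (tidealMr _ tI); exact: (tidealMl _ tI).
Qed.

(** Modulo the kernel at [U0], [a] is a combination of coset representatives;
    modulo the ideal, each of them may be moved within its coset of [U]. *)
Lemma rel_ideal_coarse n (U0 U : open_normal F) a :
    (forall a, cga_coef a U0 =1 (fun=> 0) -> nclow n (phi a)) ->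
    on_set U0 `<=` on_set U -> (on_set U `<=` congr_one n) ->
  cga_coef a U =1 (fun=> 0) -> rel_ideal n (phi a).
Proof.
move=> U0n U0U Un aU; have tI := rel_ideal_ideal n.
rewrite -(subrK (group_sum U0 (cga_coef a U0)) a) (rmorphD phi).
apply: (tidealD tI).
  apply/nclow_rel_ideal/U0n => g.
  by rewrite cga_coefB group_sum_coef ?subrr //; exact: cga_cconst.
rewrite -[group_sum _ _]subr0 -(coset_sum_rep_vanish U0U aU).
rewrite /group_sum /coset_sum !fsbig_finite; [|exact: on_fin..].
rewrite -sumrB rmorph_sum; apply: (tideal_sum _ tI) => C _.
set x := xget 1%g C; set y := xget 1%g (lcoset U x).
rewrite -scalerBr [X in rel_ideal n X](linearZ_LR phi); apply: (tidealZ _ tI).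
have -> : cga_of p x - cga_of p y = cga_of p y * (cga_of p (y^-1 * x)%g - 1).
  by rewrite mulrBr mulr1 -cga_ofM mulVKg.
rewrite (rmorphM phi); apply: (tidealMl _ tI); apply: Un.
exact: (lcoset_sym (xgetI 1%g (lcoset_refl U x))).
Qed.

(** The group elements congruent to 1 modulo [I + E_n] form an open normal
    subgroup that contains the relators, hence the whole kernel of [pi]. So it is
    the preimage of an open normal subgroup [V] of G, and the component of [f]
    at [V] already determines [f] modulo [I + E_n]. *)
Lemma theta_kernel n f : theta f = 0 -> rel_ideal n f.
Proof.
move=> f0; have [U0 U0n] := phi_cont n.
have tI := rel_ideal_ideal n; have sN := congr_one_subgroup n.
have U0N : on_set U0 `<=` congr_one n.
  move=> x U0x; apply/nclow_rel_ideal/U0n => y.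
  rewrite cga_coefB; apply/eqP; rewrite subr_eq0; apply/eqP.
  by apply: cga_of_coarser; apply: lcoset_sym; rewrite /lcoset /= invg1 mul1g.
have NN : N `<=` congr_one n.
  rewrite N_gen; apply: smallest_sub.
    by split=> //; exact: closed_overgroup sN U0N.
  by move=> r Rr; apply: ideal_addl; [exact: nclow_ideal|]; apply: sub_ideal_gen;
    exists r.
have pi1 : pi 1%g = 1%g by apply: (mulgI (pi 1%g)); rewrite -piM !mulg1.
have piV x : pi x^-1%g = (pi x)^-1%g.
  by apply: (mulgI (pi x)); rewrite -piM !mulgV pi1.
(* [congr_one n] contains the kernel of [pi], so it is saturated. *)
have sat x y : pi x = pi y -> congr_one n y -> congr_one n x.
  move=> xy ny; have [_ HM _] := sN; rewrite -(mulVKg y x); apply: HM => //.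
  by apply: NN; rewrite -N_ker /= piM piV xy mulVg.
pose V : set G := [set y | congr_one n (s y)].
have piVE : pi @^-1` V = congr_one n.
  by apply/seteqP; split=> x; apply: sat; rewrite piK.
have sV : normal_subgroup V.
  have [[H1 HM HV] HJ] := congr_one_normal n; split; [split|].
  - by apply: sat H1; rewrite piK pi1.
  - by move=> y z Vy Vz; apply: sat (HM _ _ Vy Vz); rewrite piM !piK.
  - by move=> y Vy; apply: sat (HV _ Vy); rewrite piV !piK.
  - by move=> y z Vz; apply: sat (HJ (s y) _ Vz); rewrite /conjg !piM piV !piK.
have fV : finite_set (lcosets V).
  apply: (@sub_finite_set _ _ ((fun C => pi @` C) @` lcosets (congr_one n)));
    last exact/finite_image/(finite_overgroup sN U0N).
  move=> C [y _ <-]; exists (lcoset (congr_one n) (s y)); first by exists (s y).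
  rewrite -piVE (lcoset_preimage piM) piK.
  apply/seteqP; split=> [_ [x xy <-] //|z yz].
  by exists (s z); rewrite /= piK.
have oV : open V by apply/pi_open; rewrite piVE; exact: open_overgroup sN U0N.
pose Vo : open_normal G := OpenNormal (And3 oV sV fV).
rewrite -[f]psiK; apply: (rel_ideal_coarse U0n (U := preimage_on piM pi_open Vo)).
- by rewrite /= piVE.
- by rewrite /= piVE.
- move=> x; rewrite -(cga_push_coef piM piK pi_open (psi f) Vo x).
  by rewrite -[cga_push _ _ _ _]/(theta f) f0.
Qed.

Lemma cga_filt_thetaE n f : cga_filt n (theta f) <-> rel_ideal n f.
Proof.
split=> [/cga_filt_theta[g gn fg]|[g gI fg]].
  rewrite -(subrK g f); apply: (tidealD (rel_ideal_ideal n)).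
    by apply: theta_kernel; rewrite thetaB fg subrr.
  exact: nclow_rel_ideal.
apply/cga_filt_theta; exists (f - g) => //.
by rewrite thetaB (theta_relators gI) subr0.
Qed.

End Kernel.

End Presentation.

(** * Leading factors of words *)
Section Words.
Variables (T : eqType) (src tgt : pred T) (lead : rel T).
Hypothesis lead_src : forall i j, lead i j -> src i.
Hypothesis lead_tgt : forall i j, lead i j -> tgt j.
Hypothesis src_tgt : forall i, src i -> ~~ tgt i.
Implicit Types (a b c w : seq T) (x i j u v : T).

(** Finds the leftmost factor [i j] with [lead i j]. Such a factor begins with a
    source and ends with a target, and no letter is both: two of them never
    overlap. *)
Fixpoint split_lead w : option (seq T * T * T * seq T) :=
  if w is i :: t then
    if t is j :: b then
      if lead i j then Some ([::], i, j, b) else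
      omap (fun s => (i :: s.1.1.1, s.1.1.2, s.1.2, s.2)) (split_lead t)
    else None
  else None.

Arguments split_lead : simpl never.

Lemma split_lead_cons2 x y w : split_lead (x :: y :: w) =
  if lead x y then Some ([::], x, y, w) else
  omap (fun s => (x :: s.1.1.1, s.1.1.2, s.1.2, s.2)) (split_lead (y :: w)).
Proof. by []. Qed.

Lemma split_leadP w a i j b : split_lead w = Some (a, i, j, b) ->
  [/\ w = a ++ i :: j :: b, lead i j & split_lead a = None].
Proof.
elim: w a i j b => [//|x [//|y w] IH] a i j b; rewrite split_lead_cons2.
case: ifP => [xy [<- <- <- <-] //|xy].
case E: (split_lead _) => [[[[a' i'] j'] b']|] //= [<- <- <- <-].
have [ew ij a'N] := IH _ _ _ _ E; rewrite ew; split=> //.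
case: a' a'N ew {E} => [//|z a'] a'N [ey _].
by rewrite split_lead_cons2 -ey xy ey a'N.
Qed.

Lemma split_lead_cat a i j b : split_lead a = None -> lead i j ->
  split_lead (a ++ i :: j :: b) = Some (a, i, j, b).
Proof.
move=> aN ij; elim: a aN => [|x [|y a] IH]; rewrite ?cat0s.
- by rewrite split_lead_cons2 ij.
- move=> _; rewrite !split_lead_cons2 ij ifF //; apply/negP => /lead_tgt.
  by rewrite (negbTE (src_tgt (lead_src ij))).
rewrite !cat_cons !split_lead_cons2; case: ifP => // _.
by case E: (split_lead (y :: a)) => // _; move: (IH E); rewrite cat_cons => ->.
Qed.

Lemma split_lead_free a u b : split_lead a = None -> ~~ src u -> ~~ tgt u ->
  split_lead b = None -> split_lead (a ++ u :: b) = None.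
Proof.
move=> aN us ut bN.
have ubN : split_lead (u :: b) = None.
  case: b bN => [//|y b] bN; rewrite split_lead_cons2 bN ifF //.
  by apply/negP => /lead_src; rewrite (negbTE us).
elim: a aN => [|x [|y a] IH]; rewrite ?cat0s //.
  move=> _; rewrite split_lead_cons2 ubN ifF //.
  by apply/negP => /lead_tgt; rewrite (negbTE ut).
rewrite !cat_cons !split_lead_cons2; case: ifP => // _.
by case E: (split_lead (y :: a)) => // _; move: (IH E); rewrite cat_cons => ->.
Qed.

(** The sum of the positions of the targets; moving a target to the left
    decreases it. *)
Fixpoint tgt_weight w : nat :=
  if w is x :: t then tgt_weight t + count tgt t else 0.

Lemma tgt_weight_le w : (tgt_weight w <= size w * size w)%N.
Proof.
elim: w => [//|x w IH] /=.
by rewrite (leq_trans (leq_add IH (count_size _ _))) // -mulnSr leq_mul.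
Qed.

Lemma tgt_weight_swap a i j b : lead i j ->
  (tgt_weight (a ++ j :: i :: b) < tgt_weight (a ++ i :: j :: b))%N.
Proof.
move=> ij; elim: a => [|x a IH] /=.
  rewrite (negbTE (src_tgt (lead_src ij))) (lead_tgt ij) add0n add1n addnS.
  by [].
by rewrite !count_cat /= [(tgt j + _)%N]addnCA ltn_add2r.
Qed.

Variable n : nat.

(** The lexicographic order on the pair of codegree and weight, as one number:
    the weight of a word shorter than n is at most [n * n]. *)
Definition word_rank w : nat :=
  if (n <= size w)%N then 0%N else ((n - size w) * (n * n).+1 + tgt_weight w)%N.

Lemma word_rankE w : (size w < n)%N ->
  word_rank w = ((n - size w) * (n * n).+1 + tgt_weight w)%N.
Proof. by rewrite /word_rank ltnNge => /negbTE ->. Qed.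

Lemma word_rank_swap a i j b : lead i j -> (size (a ++ i :: j :: b) < n)%N ->
  (word_rank (a ++ j :: i :: b) < word_rank (a ++ i :: j :: b))%N.
Proof.
move=> ij wn; have e : size (a ++ j :: i :: b) = size (a ++ i :: j :: b).
  by rewrite !size_cat.
by rewrite !word_rankE ?e // ltn_add2l tgt_weight_swap.
Qed.

Lemma word_rank_longer w w' : (size w < size w')%N -> (size w < n)%N ->
  (word_rank w' < word_rank w)%N.
Proof.
move=> ww' wn; rewrite (word_rankE wn).
have [w'n|w'n] := ltnP (size w') n; last first.
  by rewrite {1}/word_rank w'n addn_gt0 muln_gt0 subn_gt0 wn.
rewrite word_rankE // (leq_trans _ (leq_addr _ _)) //.
have lt : (n - size w' < n - size w)%N by rewrite ltn_sub2l.
apply: leq_trans (leq_mul lt (leqnn _)); rewrite mulSn addnC ltn_add2r ltnS.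
by rewrite (leq_trans (tgt_weight_le _)) // leq_mul // ltnW.
Qed.

End Words.

(** * Reduction of words to a fixed degree *)

(** The relations are [X_i X_j - X_j X_i + h i j] for [lead i j], with [h i j] of
    order 3. [mon] sends the words of length n to a vector space [V]. *)
Section Reduction.
Variables (p d : nat) (V : lmodType 'F_p) (mon : seq 'I_d -> V).
Variables (src tgt : pred 'I_d) (lead : rel 'I_d).
Hypothesis lead_src : forall i j, lead i j -> src i.
Hypothesis lead_tgt : forall i j, lead i j -> tgt j.
Hypothesis src_tgt : forall i, src i -> ~~ tgt i.
Variable h : 'I_d -> 'I_d -> ncseries p d.
Hypothesis h3 : forall i j, lead i j -> nclow 3 (h i j).
Variable n : nat.
Implicit Types (a b w : seq 'I_d) (i j u v : 'I_d) (f g : ncseries p d).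

Definition word_sum (L : seq 'I_d -> V) f : V :=
  \sum_(k < n.+1) \sum_(t : k.-tuple 'I_d) ncoef f t *: L t.

(** Uses the relations as rewriting rules [i j -> j i - h i j], always at the
    leftmost leading factor. A step swaps two letters or makes the word longer;
    words of length n are kept, while longer ones and words shorter than n without
    leading factor are discarded. The argument [k] bounds the number of steps. *)
Fixpoint reduce_rec k w : V :=
  if k is k'.+1 then
    if (n <= size w)%N then if size w == n then mon w else 0
    else if split_lead lead w is Some (a, i, j, b) then
      reduce_rec k' (a ++ j :: i :: b)
        - word_sum (fun t => reduce_rec k' (a ++ t ++ b)) (h i j)
    else 0
  else 0.

Definition reduce w : V := reduce_rec (word_rank tgt n w).+1 w.

Lemma eq_word_sum L L' i j : lead i j ->
    (forall t, (2 < size t)%N -> L t = L' t) ->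
  word_sum L (h i j) = word_sum L' (h i j).
Proof.
move=> ij LL; apply: eq_bigr => k _; apply: eq_bigr => t _.
have [t2|t2] := ltnP 2 (size t); first by rewrite LL.
by rewrite (h3 ij) ?scale0r.
Qed.

Lemma word_rank_insert a i j b t : (2 < size t)%N ->
  (size (a ++ i :: j :: b) < n)%N ->
  (word_rank tgt n (a ++ t ++ b) < word_rank tgt n (a ++ i :: j :: b))%N.
Proof.
move=> t2; apply: word_rank_longer.
by rewrite !size_cat /= ltn_add2l -[(size b).+2]/(2 + size b)%N ltn_add2r.
Qed.

Lemma reduce_recE k w : (word_rank tgt n w < k)%N -> reduce_rec k w = reduce w.
Proof.
suff gen k1 k2 : (word_rank tgt n w < k1)%N -> (word_rank tgt n w < k2)%N ->
  reduce_rec k1 w = reduce_rec k2 w by move=> wk; apply: gen.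
elim: k1 k2 w {k} => [//|k1 IH] [//|k2] w; rewrite !ltnS => wk1 wk2.
rewrite [reduce_rec k1.+1 w]/= [reduce_rec k2.+1 w]/=.
have [nw|wn] := leqP n (size w); first by [].
case E: (split_lead lead w) => [[[[a i] j] b]|]; last by [].
have [ew ij _] := split_leadP E; rewrite {}ew in wk1 wk2 wn {E}.
have lt := word_rank_swap lead_src lead_tgt src_tgt ij wn.
apply: (f_equal2 (fun q r => q - r)); first by apply: IH; exact: leq_trans lt _.
apply: eq_word_sum => // t /(@word_rank_insert a i j b)/(_ wn) lt'.
by apply: IH; exact: leq_trans lt' _.
Qed.

Lemma reduce_top w : (n <= size w)%N ->
  reduce w = if size w == n then mon w else 0.
Proof. by rewrite /reduce /= => ->. Qed.

Lemma reduce_normal w : (size w < n)%N -> split_lead lead w = None ->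
  reduce w = 0.
Proof. by move=> wn wN; rewrite /reduce /= leqNgt wn wN. Qed.

Lemma reduce_split a i j b : (size (a ++ i :: j :: b) < n)%N -> lead i j ->
    split_lead lead a = None ->
  reduce (a ++ i :: j :: b) =
    reduce (a ++ j :: i :: b) - word_sum (fun t => reduce (a ++ t ++ b)) (h i j).
Proof.
move=> wn ij aN; rewrite {1}/reduce /= leqNgt wn /=.
rewrite (split_lead_cat lead_src lead_tgt src_tgt b aN ij).
apply: (f_equal2 (fun q r => q - r)).
  by rewrite reduce_recE // (word_rank_swap lead_src lead_tgt src_tgt).
apply: eq_word_sum => // t t2; rewrite reduce_recE //.
exact: word_rank_insert.
Qed.

(** The linear and continuous extension of [reduce] to power series. *)
Definition reduces f : V := word_sum reduce f.

Lemma reducesD f g : reduces (f + g) = reduces f + reduces g.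
Proof.
rewrite -big_split; apply: eq_bigr => k _; rewrite -big_split.
by apply: eq_bigr => t _; rewrite ncoefD scalerDl.
Qed.

Lemma reducesZ c f : reduces (c *: f) = c *: reduces f.
Proof.
rewrite scaler_sumr; apply: eq_bigr => k _; rewrite scaler_sumr.
by apply: eq_bigr => t _; rewrite ncoefZ scalerA.
Qed.

Lemma reducesB f g : reduces (f - g) = reduces f - reduces g.
Proof. by rewrite -[- g]scaleN1r reducesD reducesZ scaleN1r. Qed.

Lemma reduces0 : reduces 0 = 0.
Proof. by rewrite -(scale0r 0) reducesZ scale0r. Qed.

Lemma reduces_low f : nclow n.+1 f -> reduces f = 0.
Proof.
move=> fn; rewrite /reduces /word_sum big1 // => k _; rewrite big1 // => t _.
by rewrite fn ?scale0r // size_tuple.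
Qed.

Lemma reduces_sum (T : Type) (r : seq T) (P : pred T) (F : T -> ncseries p d) :
  reduces (\sum_(i <- r | P i) F i) = \sum_(i <- r | P i) reduces (F i).
Proof. by apply: (big_morph _ reducesD reduces0). Qed.

Lemma reduces_word w : reduces (ncword p w) = reduce w.
Proof.
have [wn|nw] := leqP (size w) n; last first.
  rewrite reduces_low; last by apply: nclowS nw _ _; exact: nclow_word.
  by rewrite reduce_top ?(ltnW nw) // gtn_eqF.
rewrite /reduces /word_sum (bigD1 (Ordinal (wn : size w < n.+1)%N)) //=.
rewrite (bigD1 (in_tuple w)) //= eqxx scale1r !big1 ?addr0 // => [k ne|t ne].
  rewrite big1 // => t _; case: eqP => [e|]; last by rewrite scale0r.
  by case/eqP: ne; apply/val_inj; rewrite /= -e size_tuple.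
by rewrite -[_ == _ :> seq _]/(t == in_tuple w) (negbTE ne) scale0r.
Qed.

Lemma reduces_trunc f g g' :
  reduces (g * f * g') = word_sum (fun t => reduces (g * ncword p t * g')) f.
Proof.
rewrite -{1}[f](subrK (nctrunc n f)).
rewrite mulrDr mulrDl reducesD [X in X + _]reduces_low ?add0r; last first.
  apply: (tidealMr _ (@nclow_ideal _ _ _)).
  by apply: (tidealMl _ (@nclow_ideal _ _ _)); exact: nctruncP.
rewrite mulr_sumr mulr_suml reduces_sum; apply: eq_bigr => k _.
rewrite mulr_sumr mulr_suml reduces_sum; apply: eq_bigr => t _.
by rewrite -reducesZ ncscaleAr -scalerAl.
Qed.

Lemma reduces_words f a b :
  reduces (ncword p a * f * ncword p b) =
    word_sum (fun t => reduce (a ++ t ++ b)) f.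
Proof.
rewrite reduces_trunc; apply: eq_bigr => k _; apply: eq_bigr => t _.
by rewrite !ncwordM reduces_word catA.
Qed.

Variable J : set (V).
Hypothesis J0 : J 0.
Hypothesis JD : forall q r, J q -> J r -> J (q + r).
Hypothesis JZ : forall c q, J q -> J (c *: q).

Let JN q : J q -> J (- q). Proof. by rewrite -scaleN1r; exact: JZ. Qed.
Let JB q r : J q -> J r -> J (q - r).
Proof. by move=> Jq Jr; apply: JD => //; exact: JN. Qed.
Let Jsum (T : Type) (s : seq T) (P : pred T) (F : T -> V) :
  (forall x, P x -> J (F x)) -> J (\sum_(x <- s | P x) F x).
Proof. by move=> JF; elim/big_ind: _. Qed.

Lemma word_sum_ideal m (L : seq 'I_d -> V) f :
  nclow m f -> (forall t, (m <= size t)%N -> J (L t)) -> J (word_sum L f).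
Proof.
move=> fm JL; apply: Jsum => k _; apply: Jsum => t _.
have [tm|mt] := ltnP (size t) m; last by apply: JZ; exact: JL.
by rewrite fm // scale0r.
Qed.

Lemma reduces_ideal_series f :
    (forall a b, J (reduces (ncword p a * f * ncword p b))) ->
  forall g g', J (reduces (g * f * g')).
Proof.
move=> Jf g g'; rewrite -[g]mul1r -[_ * f * g']mulrA reduces_trunc.
apply: (@word_sum_ideal 0) => // t _.
rewrite -[_ * _]mulr1 -mulrA -[_ * 1]mulrA mulr1 !mulrA.
rewrite -[_ * g']mulr1 reduces_trunc; apply: (@word_sum_ideal 0) => // t' _.
by rewrite mulr1 mul1r.
Qed.

Lemma reduces_low_word a b f : nclow 1 f -> (n <= size a + size b)%N ->
  reduces (ncword p a * f * ncword p b) = 0.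
Proof.
move=> f1 nab; apply: reduces_low.
apply: (@nclowS _ _ _ (size a + 1 + size b)); first by rewrite addn1 addSn ltnS.
by apply: nclowM; [apply: nclowM|] => //; exact: nclow_word.
Qed.

Definition lead_rel i j : ncseries p d :=
  ncword p [:: i; j] - ncword p [:: j; i] + h i j.

(** [J] stands for the span of the commutation relations in degree n. *)
Definition commute_mod u v :=
  forall a b, J (mon (a ++ u :: v :: b) - mon (a ++ v :: u :: b)).

Hypothesis J_lead : forall i j, lead i j -> commute_mod i j.

Lemma reduces_comm_words a b u v :
  reduces (ncword p a * (ncword p [:: u; v] - ncword p [:: v; u]) * ncword p b)
    = reduce (a ++ u :: v :: b) - reduce (a ++ v :: u :: b).
Proof. by rewrite mulrBr mulrBl reducesB !ncwordM !reduces_word -!catA. Qed.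

Lemma reduce_comm_top a b u v : (n <= size (a ++ u :: v :: b))%N ->
    commute_mod u v ->
  J (reduce (a ++ u :: v :: b) - reduce (a ++ v :: u :: b)).
Proof.
move=> nw Juv; have e : size (a ++ v :: u :: b) = size (a ++ u :: v :: b).
  by rewrite !size_cat.
rewrite !reduce_top ?e //; case: eqP => _; first exact: Juv.
by rewrite subrr.
Qed.

(** If [a] has no leading factor, the displayed [i j] is the leftmost one of the
    word [a i j b], whatever [b] is, and the definition of [reduce] applies. In
    degree n only [J] remains to be used, since [h i j] contributes nothing. *)
Lemma reduces_rel_normal a b i j : lead i j -> split_lead lead a = None ->
  J (reduces (ncword p a * lead_rel i j * ncword p b)).
Proof.
move=> ij aN; rewrite mulrDr mulrDl reducesD reduces_comm_words reduces_words.
have [wn|nw] := ltnP (size (a ++ i :: j :: b)) n.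
  by rewrite reduce_split // addrAC subrK subrr.
apply: JD; first by apply: reduce_comm_top => //; exact: J_lead.
apply: (word_sum_ideal (h3 ij)) => t t3; rewrite reduce_top.
  rewrite gtn_eqF //.
  by apply: leq_trans (_ : _ < size a + (3 + size b))%N _;
    rewrite ?(leq_ltn_trans nw) // !size_cat /= ?leq_add2l ?leq_add2r // ltn_add2l.
apply: leq_trans nw _.
by rewrite !size_cat /= leq_add2l (leq_add2r (size b) 2) ltnW.
Qed.

Lemma reduces_rel_series a g i j : lead i j -> split_lead lead a = None ->
  J (reduces (ncword p a * lead_rel i j * g)).
Proof.
move=> ij aN; rewrite -[_ * g]mulr1 reduces_trunc.
apply: (@word_sum_ideal 0) => // t _; rewrite mulr1.
exact: reduces_rel_normal.
Qed.

Lemma ncword_lead a i j b : ncword p (a ++ i :: j :: b) =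
  ncword p a * lead_rel i j * ncword p b + ncword p (a ++ j :: i :: b)
    - ncword p a * h i j * ncword p b.
Proof.
rewrite /lead_rel !mulrDr !mulrDl mulrN mulNr !ncwordM -!catA /=.
by rewrite addrAC addrK subrK.
Qed.

(** As leading factors do not overlap, the one rewritten first in [a w b] lies in
    [a] as soon as [a] has one, for every word [w]. So rewriting [a] commutes with
    the choice of [w], and induction on the rank of [a] applies. *)
Lemma reduces_left f : nclow 1 f ->
    (forall a b, split_lead lead a = None ->
       J (reduces (ncword p a * f * ncword p b))) ->
  forall a b, J (reduces (ncword p a * f * ncword p b)).
Proof.
move=> f1 Jf a b; have [k] := ubnP (word_rank tgt n a).
elim: k a => // k IH a; rewrite ltnS => ak.
have [na|an] := leqP n (size a).
  by rewrite reduces_low_word ?(leq_trans na) ?leq_addr.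
case E: (split_lead lead a) => [[[[a' i] j] a'']|]; last exact: Jf.
have [ea ij a'N] := split_leadP E; rewrite {E}ea in ak an *.
rewrite ncword_lead !mulrDl !mulNr reducesB reducesD.
apply: JB; [apply: JD|].
- by rewrite -!mulrA mulrA; exact: reduces_rel_series.
- apply: IH; apply: leq_trans ak.
  exact: (word_rank_swap lead_src lead_tgt src_tgt).
- rewrite -!mulrA mulrA reduces_trunc.
  apply: (word_sum_ideal (h3 ij)) => t t3.
  rewrite !mulrA !ncwordM -catA; apply: IH; apply: leq_trans ak.
  exact: word_rank_insert.
Qed.

Lemma reduces_rel a b i j : lead i j ->
  J (reduces (ncword p a * lead_rel i j * ncword p b)).
Proof.
move=> ij; apply: reduces_left => [|a' b' a'N]; last exact: reduces_rel_normal.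
apply: nclowD; last exact: (nclowS _ (h3 ij)).
by apply: nclowB; apply: nclowS (@nclow_word _ _ _).
Qed.

(** Letters [u], [v] outside all leading factors: after [a], the word [b] is
    rewritten in the same way behind [u v] and behind [v u]. *)
Lemma reduces_free_comm a b u v :
    ~~ src u -> ~~ tgt u -> ~~ src v -> ~~ tgt v ->
    commute_mod u v ->
  J (reduces (ncword p a * ring_comm (ncvar p u) (ncvar p v) * ncword p b)).
Proof.
move=> us ut vs vt Juv.
have freeN a' b' x y : ~~ src x -> ~~ tgt x -> ~~ src y -> ~~ tgt y ->
    split_lead lead a' = None -> split_lead lead b' = None ->
    split_lead lead (a' ++ x :: y :: b') = None.
  move=> xs xt ys yt a'N b'N; apply: (split_lead_free lead_src lead_tgt) => //.
  by rewrite -[y :: b']cat0s; apply: (split_lead_free lead_src lead_tgt).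
rewrite /ring_comm !ncvarE !ncwordM /=; set c := _ - _.
have c1 : nclow 1 c.
  by apply: nclowB; apply: nclowS (@nclow_word _ _ _).
apply: reduces_left => // {}a {}b aN.
have [k] := ubnP (word_rank tgt n b).
elim: k b => // k IH b; rewrite ltnS => bk.
have [nb|bn] := leqP n (size b).
  by rewrite reduces_low_word ?(leq_trans nb) ?leq_addl.
case E: (split_lead lead b) => [[[[b' i] j] b'']|]; last first.
  rewrite reduces_comm_words.
  have [wn|nw] := ltnP (size (a ++ u :: v :: b)) n; last exact: reduce_comm_top.
  rewrite !reduce_normal ?freeN //; first by rewrite subrr.
  by move: wn; rewrite !size_cat.
have [eb ij b'N] := split_leadP E; rewrite {E}eb in bk bn *.
rewrite ncword_lead mulrBr mulrDr reducesB reducesD.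
apply: JB; [apply: JD|].
- rewrite /c !mulrA mulrBr !mulrBl reducesB !ncwordM -!catA.
  by apply: JB; apply: reduces_rel_normal => //; exact: freeN.
- apply: IH; apply: leq_trans bk.
  exact: (word_rank_swap lead_src lead_tgt src_tgt).
- rewrite !mulrA (reduces_trunc (h i j)).
  apply: (word_sum_ideal (h3 ij)) => t t3.
  rewrite -[_ * ncword p b' * _]mulrA ncwordM -mulrA ncwordM -catA.
  by apply: IH; apply: leq_trans bk; exact: word_rank_insert.
Qed.

(** The series whose two-sided multiples all reduce into [J] form an ideal. *)
Lemma reduces_ideal_gen (S : set (ncseries p d)) f :
    (forall r, S r -> forall g g', J (reduces (g * r * g'))) ->
  ideal_add (ideal_gen S) (nclow n.+1) f -> J (reduces f).
Proof.
move=> JS [f' f'S ff']; rewrite -[f](subrK f') reducesD reduces_low // add0r.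
pose K : set (ncseries p d) := [set r | forall g g', J (reduces (g * r * g'))].
suff : K f' by move=> /(_ 1 1); rewrite mul1r mulr1.
apply: (@ideal_gen_min _ S K _ JS) f'S; split.
- by move=> g g'; rewrite mulr0 mul0r reduces0.
- move=> r s Kr Ks g g'; rewrite mulrDr mulrDl reducesD.
  by apply: JD; [exact: Kr|exact: Ks].
- by move=> s r Kr; split=> g g'; [rewrite mulrA|rewrite mulrA -mulrA]; exact: Kr.
Qed.

End Reduction.

(** * Noncommutative polynomials and their homogeneous parts *)
Section Monomials.
Variables p d : nat.
Implicit Types (v w : seq 'I_d).

Definition ncmon w : ncpoly p d := << FMonom w >>.

Lemma ncmonM v w : ncmon v * ncmon w = ncmon (v ++ w).
Proof.
rewrite malgME !msuppU1 !big_seq_fset1 !mcoeffUU mulr1.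
by congr << _ >>; apply/eqP; rewrite -val_eqE /= fmM.
Qed.

Lemma ncmon_cat2 (i j : 'I_d) v w : ncmon (v ++ i :: j :: w) =
  ncmon v * (ncmon [:: i] * (ncmon [:: j] * ncmon w)).
Proof.
rewrite -(ncmonM v ([:: i] ++ [:: j] ++ w)).
by rewrite -(ncmonM [:: i] ([:: j] ++ w)) -(ncmonM [:: j] w).
Qed.

Lemma ncmonX (i : 'I_d) : ncpolyX p i = ncmon [:: i].
Proof. by rewrite /ncpolyX fmuE. Qed.

End Monomials.

Section HomogeneousParts.
Variables p d : nat.
Implicit Types (f g : ncseries p d) (q r : ncpoly p d) (w : seq 'I_d).

Definition nchom n f : ncseries p d :=
  NCSeries (fun w => if size w == n then ncoef f w else 0).

Lemma nchomD n f g : nchom n (f + g) = nchom n f + nchom n g.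
Proof. by apply: ncP => w; rewrite ncoefD /=; case: eqP; rewrite ?addr0. Qed.

Lemma nchomB n f g : nchom n (f - g) = nchom n f - nchom n g.
Proof. by apply: ncP => w; rewrite ncoefB /=; case: eqP; rewrite ?subr0. Qed.

Lemma nchom_word n w :
  nchom n (ncword p w) = if size w == n then ncword p w else 0.
Proof.
apply: ncP => v /=; case: (eqVneq v w) => [->|vw].
  by case: ifP => //= _; rewrite eqxx.
by rewrite if_same; case: ifP => //= _; rewrite (negbTE vw).
Qed.

Lemma nchom_low n f : nclow n (nchom n f).
Proof. by move=> w wn /=; rewrite ltn_eqF. Qed.

Lemma nchomM n f g :
  nchom n (f * g) = \sum_(k < n.+1) nchom k f * nchom (n - k)%N g.
Proof.
apply: ncP => w; rewrite ncoef_sum.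
under eq_bigr do rewrite ncoefM.
have [wn|wn] := eqVneq (size w) n; last first.
  rewrite [LHS]/= (negbTE wn) big1 // => k _; rewrite big1 // => i _ /=.
  case: eqP => [ek|]; last by rewrite mul0r.
  case: eqP => [en|]; last by rewrite mulr0.
  move/eqP: wn; case; rewrite -(cat_take_drop i w) size_cat ek en subnKC //.
  by rewrite -ltnS.
rewrite [LHS]/= wn eqxx -wn exchange_big; apply: eq_bigr => i _.
have iw : (i <= size w)%N by rewrite -ltnS.
rewrite (bigD1 i) // big1 => [|k ki] /=; rewrite size_takel // size_drop.
  by rewrite !eqxx addr0.
by rewrite [_ == _ :> nat]eq_sym -[_ == _ :> nat]/(k == i) (negbTE ki) mul0r.
Qed.

Definition ncser q : ncseries p d := NCSeries (fun w => q@_(FMonom w)).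

Lemma ncserD q r : ncser (q + r) = ncser q + ncser r.
Proof. by apply: ncP => w; rewrite ncoefD /= mcoeffD. Qed.

Lemma ncserB q r : ncser (q - r) = ncser q - ncser r.
Proof. by apply: ncP => w; rewrite ncoefB /= mcoeffB. Qed.

Lemma ncser0 : ncser 0 = 0.
Proof. by apply: ncP => w; rewrite /= mcoeff0. Qed.

Lemma ncser_sum (T : Type) (s : seq T) (P : pred T) (F : T -> ncpoly p d) :
  ncser (\sum_(i <- s | P i) F i) = \sum_(i <- s | P i) ncser (F i).
Proof. by apply: (big_morph _ ncserD ncser0). Qed.

Lemma ncserU c (m : {fmonom 'I_d}) : ncser << c *g m >> = c *: ncword p m.
Proof.
apply: ncP => w; rewrite ncoefZ /= mcoeffU -val_eqE /= eq_sym.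
by case: eqP; rewrite ?mulr1 ?mulr0.
Qed.

Lemma ncserE q : ncser q = \sum_(m <- msupp q) q@_m *: ncword p m.
Proof.
by rewrite {1}[q]monalgE ncser_sum; apply: eq_bigr => m _; rewrite ncserU.
Qed.

Lemma ncserM q r : ncser (q * r) = ncser q * ncser r.
Proof.
rewrite malgME ncser_sum [in RHS]ncserE mulr_suml; apply: eq_bigr => m _.
rewrite ncser_sum [in RHS]ncserE mulr_sumr; apply: eq_bigr => m' _.
by rewrite ncserU fmM -ncwordM ncscaleAr -scalerAl scalerA mulrC.
Qed.

Lemma ncserX (i : 'I_d) : ncser (ncpolyX p i) = ncvar p i.
Proof. by rewrite /ncpolyX ncserU fmU scale1r. Qed.

Lemma ncser_comm q r : ncser (ring_comm q r) = ring_comm (ncser q) (ncser r).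
Proof.
exact: etrans (ncserB _ _)
  (f_equal2 (fun f g => f - g) (ncserM q r) (ncserM r q)).
Qed.

Lemma nchom_ncserE n q :
  nchom n (ncser q) = \sum_(m <- msupp q | size m == n) q@_m *: ncword p m.
Proof.
apply: ncP => w; rewrite ncserE !ncoef_sum /= !ncoef_sum [in RHS]big_mkcond.
case: eqP => [wn|wn].
  apply: eq_bigr => m _; case: eqP => // mn; rewrite ncoefZ /=.
  by case: eqP => [e|]; rewrite ?mulr0 //; case: mn; rewrite -e.
rewrite big1 // => m _; case: eqP => // mn.
by case: eqP => [e|]; rewrite ?mulr0 //; case: wn; rewrite e.
Qed.

Lemma ncpoly_hom_sum (J : set (ncpoly p d)) q : two_sided_ideal J ->
    (forall n, J (\sum_(m <- msupp q | size m == n) q@_m *: ncmon p m)) ->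
  J q.
Proof.
move=> tJ Jq; have -> : q = \sum_(n < mmeasure (@fdeg _) q)
    \sum_(m <- msupp q | size m == n) q@_m *: ncmon p m.
  rewrite {1}[q]monalgE (exchange_big_dep xpredT) //=.
  rewrite big_seq [RHS]big_seq; apply: eq_bigr => m mq.
  rewrite (big_pred1 (Ordinal (mmeasure_mnm_lt (@fdeg _) mq))) => [|n]; last first.
    by rewrite eq_sym.
  rewrite /ncmon fmK; apply/malgP => k.
  by rewrite [RHS]mcoeffZ [in RHS]mcoeffU1 [LHS]mcoeffU [RHS]mulr_natr.
by apply: tideal_sum => // n _; exact: Jq.
Qed.

End HomogeneousParts.

Lemma ring_comm_sandwich (A : nzRingType) (a b x y : A) :
  a * (x * (y * b)) - a * (y * (x * b)) = a * (ring_comm x y * b).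
Proof. by rewrite mulrBl mulrBr !mulrA. Qed.

(** * Relations supported on the edges of a graph *)
Section GraphRelations.
Variables (p d : nat) (e : rel 'I_d).
Variables (VA VB : {set 'I_d}) (eA eB : rel 'I_d).
Implicit Types (i j u v : 'I_d).
Hypothesis A_graph : simple_graph VA eA.
Hypothesis B_graph : simple_graph VB eB.
Hypothesis e_union : disjoint_union e VA eA VB eB.
Variable rho : 'I_d -> 'I_d -> ncseries p d.
Hypothesis rho_A : forall i j : 'I_d, (i < j)%N -> eA i j ->
  nclow 3 (rho i j - ring_comm (ncvar p i) (ncvar p j)).
Hypothesis rho_B : forall u v : 'I_d, (u < v)%N -> eB u v ->
  exists c c' : ncseries p d, rho u v = c * ring_comm (ncvar p u) (ncvar p v) /\
    ring_comm (ncvar p u) (ncvar p v) = c' * rho u v.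

Let S : set (ncseries p d) :=
  [set r | exists i j : 'I_d, [/\ (i < j)%N, e i j & r = rho i j]].
Let J := graph_ideal p e.
Let tJ : two_sided_ideal J := ideal_gen_ideal _.

Let eP i j : e i j = eA i j || eB i j. Proof. by case: e_union. Qed.

Let A_ltgt i j : eA i j -> ((i < j) || (j < i))%N.
Proof.
have [_ irr _] := A_graph; case: ltngtP => // /val_inj ->.
by rewrite irr.
Qed.

Let A_sym : symmetric eA. Proof. by case: A_graph. Qed.

Lemma graph_ideal_commute u v : (u < v)%N -> e u v ->
  commute_mod (@ncmon p d) J u v /\ commute_mod (@ncmon p d) J v u.
Proof.
move=> uv euv.
have Juv : commute_mod (@ncmon p d) J u v.
  move=> a b; rewrite !ncmon_cat2 ring_comm_sandwich -!ncmonX.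
  apply: (tidealMl _ tJ); apply: (tidealMr _ tJ); apply: sub_ideal_gen.
  by exists u, v.
by split; [exact: Juv | move=> a b; apply: (tideal_subC tJ); exact: Juv].
Qed.

(** Homogeneous parts multiply by convolution, so it is enough to look at the
    generators: [X_i X_j - X_j X_i] is a relation up to order 3 on an edge of
    [eA], and a multiple of a relation on an edge of [eB]. *)
Lemma graph_ideal_series f : J f -> forall n,
  ideal_add (ideal_gen S) (nclow n.+1) (nchom n (ncser f)).
Proof.
pose Q n := ideal_add (ideal_gen S) (@nclow p d n).
have tQ n : two_sided_ideal (Q n).
  by apply: ideal_add_ideal; [exact: ideal_gen_ideal|exact: nclow_ideal].
have QM k m g h : nclow k g -> Q m h -> Q (k + m)%N (g * h) /\ Q (m + k)%N (h * g).
  move=> gk [h' h'S hm]; split.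
    exists (g * h'); first exact: (tidealMl _ (ideal_gen_ideal _)).
    by rewrite -mulrBr; exact: nclowM.
  exists (h' * g); first exact: (tidealMr _ (ideal_gen_ideal _)).
  by rewrite -mulrBl; exact: nclowM.
pose K : set (ncpoly p d) := [set f | forall n, Q n.+1 (nchom n (ncser f))].
suff : J `<=` K by apply.
apply: ideal_gen_min.
  split.
  - move=> n; rewrite ncser0 (_ : nchom n 0 = 0); first exact: (tideal0 (tQ n.+1)).
    by apply: ncP => w /=; case: ifP.
  - by move=> q r Kq Kr n; rewrite ncserD nchomD; exact: (tidealD (tQ n.+1)).
  - move=> q r Kr; split=> n; rewrite ncserM nchomM.
      apply: (tideal_sum (P := xpredT) _ (tQ n.+1)) => k _.
      have [QE _] := QM _ _ _ _ (nchom_low (n := k) (ncser q)) (Kr (n - k)%N).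
      by move: QE; rewrite addnS subnKC // -ltnS.
    apply: (tideal_sum (P := xpredT) _ (tQ n.+1)) => k _.
    have [_ QE] := QM _ _ _ _ (nchom_low (n := (n - k)%N) (ncser q)) (Kr k).
    by move: QE; rewrite addSn subnKC // -ltnS.
move=> _ [i [j [ij eij ->]]] n.
rewrite ncser_comm !ncserX ncvar_comm nchomB !nchom_word /= eq_sym.
case: eqP => [->|_]; last by rewrite subrr; exact: (tideal0 (tQ n.+1)).
rewrite -ncvar_comm.
have Srho : ideal_gen S (rho i j) by apply: sub_ideal_gen; exists i, j.
move: (eij); rewrite eP => /orP[eAij|eBij].
  by exists (rho i j) => //; apply: (tideal_subC (@nclow_ideal p d 3));
    exact: rho_A.
apply: ideal_addl; first exact: nclow_ideal.
have [c [c' [_ ->]]] := rho_B ij eBij.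
exact: (tidealMl _ (ideal_gen_ideal _)).
Qed.

Hypothesis A_bipartite : bipartite VA eA.

(** Reduction to degree n does not move a polynomial that is homogeneous of degree
    n, and sends the ideal of relations into the graph ideal. The leading factors
    are the edges of [eA], oriented from one side of the bipartition to the other;
    the vertices of [VB] lie outside all of them. *)
Lemma series_graph_ideal f :
    (forall n, ideal_add (ideal_gen S) (nclow n.+1) (nchom n (ncser f))) ->
  J f.
Proof.
have [V1 [V2 [V12 disj bip]]] := A_bipartite.
pose src := [pred i | i \in V1]; pose tgt := [pred i | i \in V2].
pose lead : rel 'I_d := [rel i j | [&& eA i j, src i & tgt j]].
(* A relation is indexed by its edge with [i < j]; the side of the bipartition
   that holds [i] decides the sign with which it is used. *)
pose h (i j : 'I_d) := (if (i < j)%N then rho i j else - rho j i)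
  - ring_comm (ncvar p i) (ncvar p j).
have lead_src i j : lead i j -> src i by case/and3P.
have lead_tgt i j : lead i j -> tgt j by case/and3P.
have src_tgt i : src i -> ~~ tgt i.
  by move=> /= i1; apply: contraNN (disj i) => i2; rewrite i1.
have h3 i j : lead i j -> nclow 3 (h i j).
  move=> /and3P[eij _ _]; rewrite /h; case: ltnP => ij; first exact: rho_A.
  have ji : (j < i)%N by have := A_ltgt eij; rewrite ltnNge ij.
  have -> : - rho j i - ring_comm (ncvar p i) (ncvar p j) =
      - (rho j i - ring_comm (ncvar p j) (ncvar p i)).
    by rewrite opprB addrC /ring_comm opprB.
  apply: (tidealN (@nclow_ideal p d 3)).
  by apply: rho_A; rewrite // A_sym.
have J_lead i j : lead i j -> commute_mod (@ncmon p d) J i j.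
  move=> /and3P[eAij _ _]; case/orP: (A_ltgt eAij) => ij.
    have eij : e i j by rewrite eP eAij.
    by have [Jij _] := graph_ideal_commute ij eij; exact: Jij.
  have eji : e j i by rewrite eP A_sym eAij.
  by have [_ Jij] := graph_ideal_commute ij eji; exact: Jij.
move=> fS; apply: (ncpoly_hom_sum tJ) => n.
have J0 : J 0 := tideal0 tJ.
have JD q r : J q -> J r -> J (q + r) := tidealD tJ.
have JZ c q : J q -> J (c *: q) := tidealZ c tJ.
pose red := reduces (@ncmon p d) tgt lead h n.
have <- : red (nchom n (ncser f)) =
    \sum_(m <- msupp f | size m == n) f@_m *: ncmon p m.
  rewrite nchom_ncserE /red reduces_sum; apply: eq_bigr => m /eqP mn.
  by rewrite reducesZ reduces_word reduce_top mn ?eqxx.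
have rel_lead i j : lead_rel h i j = if (i < j)%N then rho i j else - rho j i.
  by rewrite /lead_rel -ncvar_comm /h addrC subrK.
apply: (reduces_ideal_gen J0 JD _ (fS n)) => r [i [j [ij eij ->]]] g g'.
move: (eij); rewrite eP => /orP[eAij|eBij].
  have Jrel k m : lead k m -> J (red (g * lead_rel h k m * g')).
    move=> km; apply: (reduces_ideal_series J0 JD JZ) => a b.
    exact: (reduces_rel lead_src lead_tgt src_tgt h3 n J0 JD JZ J_lead).
  have /orP[/andP[i1 j2]|/andP[i2 j1]] := bip _ _ eAij.
    by rewrite -[rho i j]/(if true then rho i j else - rho j i) -ij -rel_lead;
      apply: Jrel; rewrite /lead /= eAij i1.
  have -> : rho i j = - lead_rel h j i by rewrite rel_lead ltnNge ltnW //= opprK.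
  rewrite mulrN mulNr -scaleN1r /red reducesZ; apply: JZ; apply: Jrel.
  by rewrite /lead /= A_sym eAij j1.
have [c [_ [-> _]]] := rho_B ij eBij; rewrite mulrA.
have [_ _ BV] := B_graph; have /andP[iB jB] := BV _ _ eBij.
have free k : k \in VB -> ~~ src k /\ ~~ tgt k.
  move=> kB; have [+ _] := e_union => /(_ k); rewrite kB addbT V12 negb_or.
  by case/andP.
have [[i1 i2] [j1 j2]] := (free _ iB, free _ jB).
apply: (reduces_ideal_series J0 JD JZ) => a b.
apply: (reduces_free_comm lead_src lead_tgt src_tgt h3 n J0 JD JZ J_lead) => //.
by have [Jij _] := graph_ideal_commute ij eij; exact: Jij.
Qed.

End GraphRelations.

(** * Commutators in the group and in its algebra *)
Lemma ring_comm_sub1 (A : nzRingType) (a b : A) :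
  ring_comm (a - 1) (b - 1) = ring_comm a b.
Proof.
rewrite /ring_comm !mulrBl !mulrBr !mul1r !mulr1.
have -> : b * a - b - (a - 1) = b * a - a - (b - 1).
  by rewrite !opprB [1 - a]addrC [1 - b]addrC !addrA [b * a - b - a]addrAC.
rewrite [- (b * a - a - _)]opprD addrACA subrr addr0.
by rewrite [- (b * a - a)]opprD addrACA subrr addr0.
Qed.

(** Since [y x [x; y] = x y], the relator of a commutator is the Lie commutator
    up to a unit. *)
Lemma cga_comm_sub_one (p : nat) (F : topGroupType) (x y : F) :
  ring_comm (cga_of p x - 1) (cga_of p y - 1) =
    cga_of p (y * x)%g * (cga_of p [~ x, y]%g - 1).
Proof.
have yx_comm : (y * x * [~ x, y])%g = (x * y)%g.
  by rewrite commgEl /conjg -!mulgA mulVKg mulVKg.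
by rewrite mulrBr mulr1 -cga_ofM yx_comm !cga_ofM ring_comm_sub1.
Qed.

Theorem theorem2 (p d : nat) (p_prime : prime p)
  (e : rel 'I_d) (e_graph : simple_graph [set: 'I_d]%SET e)
  (F : topGroupType) (x : 'I_d -> F) (F_free : free_pro_p p x)
  (phi : {lrmorphism cga p F -> ncseries p d}) (phi_magnus : magnus_iso x phi)
  (l : 'I_d -> 'I_d -> F)
  (VA VB : {set 'I_d}) (eA eB : rel 'I_d)
  (A_graph : simple_graph VA eA) (B_graph : simple_graph VB eB)
  (e_union : disjoint_union e VA eA VB eB)
  (A_bipartite : bipartite VA eA)
  (l_A : forall i j : 'I_d, (i < j)%N -> eA i j ->
    ncseries_filt 3 (phi (cga_of p (l i j) - 1)
                     - ring_comm (ncvar p i) (ncvar p j)))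
  (l_B : forall u v : 'I_d, (u < v)%N -> eB u v -> l u v = [~ x u, x v]%g)
  (G : topGroupType) (pi : F -> G)
  (G_presented : is_quotient_by
    (closed_normal_closure
      [set r : F | exists i j : 'I_d, [/\ (i < j)%N, e i j & r = l i j]]) pi) :
  gr_cga_eq_quotient (fun i => pi (x i)) (graph_ideal p e).
Proof.
have [piM pi_surj pi_open pi_ker] := G_presented.
have [s piK] := choice pi_surj.
have [[psi phiK psiK] phi_cont psi_cont phi_x] := phi_magnus.
set R := [set r : F | _] in pi_ker G_presented.
have {}phi_cont n : exists U : open_normal F, forall a,
    cga_coef a U =1 (fun=> 0) -> nclow n (phi a).
  by have [U HU] := phi_cont n; exists U => a /HU; rewrite ncseries_filtE.
have {}psi_cont U : exists n, forall a, nclow n (phi a) ->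
    cga_coef a U =1 (fun=> 0).
  by have [n Hn] := psi_cont U; exists n => a; rewrite -ncseries_filtE => /Hn.
have phiB a b : phi (a - b) = phi a - phi b := rmorphB phi a b.
have phiM a b : phi (a * b) = phi a * phi b := rmorphM phi a b.
have phi1 : phi 1 = 1 := rmorph1 phi.
pose th := theta piM piK pi_open psi.
have phi_xB i : phi (cga_of p (x i) - 1) = ncvar p i.
  by rewrite phiB phi1 phi_x addrC addKr.
have th_x i : th (ncvar p i) = cga_of p (pi (x i)) - 1.
  rewrite -phi_xB phiB phi1 /th (thetaB _ _ _ phiK psiK) (theta1 _ _ _ phiK).
  by rewrite (theta_phi_of _ _ _ phiK).
have th_word w : th (ncword p w) = \prod_(i <- w) (cga_of p (pi (x i)) - 1).
  elim: w => [|i w IH]; first by rewrite big_nil; exact: (theta1 _ _ _ phiK).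
  rewrite big_cons -IH -th_x -(thetaM _ _ _ phiK psiK) ncvarE ncwordM //.
have evE n f : ncpoly_eval_deg (fun i => cga_of p (pi (x i)) - 1) n f =
    th (nchom n (ncser f)).
  rewrite nchom_ncserE /th (theta_sum _ _ _ phiK psiK); apply: eq_bigr => m _.
  by rewrite (thetaZ _ _ _ phiK psiK) -/th th_word.
pose rho i j := phi (cga_of p (l i j) - 1).
have relE : relators phi R =
    [set r | exists i j : 'I_d, [/\ (i < j)%N, e i j & r = rho i j]].
  apply/seteqP; split=> [_ [_ [i [j [ij eij ->]]] <-]|_ [i [j [ij eij ->]]]].
    by exists i, j.
  by exists (l i j) => //; exists i, j.
have rho_A (i j : 'I_d) : (i < j)%N -> eA i j ->
    nclow 3 (rho i j - ring_comm (ncvar p i) (ncvar p j)).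
  by move=> ij eij; rewrite -ncseries_filtE; exact: l_A.
have rho_B (u v : 'I_d) : (u < v)%N -> eB u v -> exists c c' : ncseries p d,
    rho u v = c * ring_comm (ncvar p u) (ncvar p v) /\
    ring_comm (ncvar p u) (ncvar p v) = c' * rho u v.
  move=> uv euv; pose g := (x v * x u)%g.
  have comm_rho : ring_comm (ncvar p u) (ncvar p v) = phi (cga_of p g) * rho u v.
    rewrite -!phi_xB /rho (l_B _ _ uv euv) -phiM -cga_comm_sub_one /ring_comm.
    by rewrite [RHS]phiB !phiM.
  exists (phi (cga_of p g^-1%g)), (phi (cga_of p g)); split=> //.
  by rewrite comm_rho mulrA -phiM -cga_ofM mulVg phi1 mul1r.
have filtE :=
  cga_filt_thetaE piM piK pi_open phiK psiK phi_cont psi_cont pi_ker erefl.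
split=> [n z /(cga_filt_theta piM piK pi_open phiK psiK psi_cont)[f fn <-]|f].
  pose q : ncpoly p d := \sum_(t : n.-tuple 'I_d) << ncoef f t *g FMonom t >>.
  have qE : ncser q = \sum_(t : n.-tuple 'I_d) ncoef f t *: ncword p t.
    by rewrite ncser_sum; apply: eq_bigr => t _; rewrite ncserU.
  exists q.
  rewrite evE -(thetaB _ _ _ phiK psiK).
  apply/(cga_filt_theta piM piK pi_open phiK psiK psi_cont).
  exists (f - nchom n (ncser q)) => // w; rewrite qE ncoefB [ncoef (nchom _ _) w]/=.
  rewrite ltnS leq_eqVlt => /orP[wn|wn].
    by rewrite wn -[X in _ - X]/(ncoef _ w) ncoef_homog insubT subrr.
  by rewrite fn // ltn_eqF // subrr.
split=> [fI|If n].
  apply: (series_graph_ideal A_graph B_graph e_union rho_A rho_B A_bipartite).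
  by move=> n; move: (fI n); rewrite evE => /filtE; rewrite /rel_ideal relE.
rewrite evE; apply/filtE; rewrite /rel_ideal relE.
exact: (graph_ideal_series e_union rho_A rho_B).
Qed.
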